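(* Let $p$ be a prime, $t\ge 1$, $q=p^t$. Let $H$ be a Hermitian unital embedded in $\operatorname{PG}(2,q^2)$ and let $U$ be any other unital embedded in $\operatorname{PG}(2,q^2)$. Then $$|H\cap U|\equiv 1 \pmod{p^{\lceil t/2\rceil}}.$$ Moreover, if $U$ is a Buekenhout–Metz unital, then $$|H\cap U|\equiv 1 \pmod{q}.$$
   Context: A unital embedded in the projective plane $\operatorname{PG}(2,q^2)$ is a set of $q^3+1$ points such that every line of the plane meets it in exactly $1$ or $q+1$ points. A Hermitian (classical) unital is the set of projective points where a nondegenerate Hermitian (unitary) form on $\mathbb{F}_{q^2}^3$ vanishes; every such set is projectively equivalent to $\{\langle(x,y,z)\rangle : x^{q+1}+y^{q+1}+z^{q+1}=0\}$. A Buekenhout–Metz unital is a unital in $\operatorname{PG}(2,q^2)$ projectively equivalent to a set of the form $$U_{\alpha,\beta}=\{\langle(1,y,\alpha y^2+\beta y^{q+1}+r)\rangle : y\in\mathbb{F}_{q^2},\ r\in\mathbb{F}_q\}\cup\{\langle(0,0,1)\rangle\}$$ for some $\alpha,\beta\in\mathbb{F}_{q^2}$ (for which this set is a unital; for $\alpha\neq 0$ this holds iff $(\beta^q-\beta)^2+4\alpha^{q+1}$ is a nonsquare in $\mathbb{F}_q$ when $q$ is odd, resp. $\operatorname{Tr}_{\mathbb{F}_q/\mathbb{F}_2}\big((\beta^q+\beta)/\alpha^{q+1}\big)=1$ when $q$ is even). *)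

(* Defs.v *)
From HB Require Import structures.
From mathcomp Require Import all_boot all_order all_algebra all_fingroup all_field.
Set Implicit Arguments. Unset Strict Implicit. Unset Printing Implicit Defensive.
Import GRing.Theory.
Local Open Scope ring_scope.

Section PG2.
Variable F : finFieldType.

Definition i0 : 'I_3 := @Ordinal 3 0 isT.
Definition i1 : 'I_3 := @Ordinal 3 1 isT.
Definition i2 : 'I_3 := @Ordinal 3 2 isT.

Definition row3 (a b c : F) : 'rV[F]_3 :=
  \row_(i < 3) (if i == i0 then a else if i == i1 then b else c).

(* canonical representative of a projective point: first nonzero coordinate is 1 *)
Definition normalized (v : 'rV[F]_3) : bool :=
  (v 0 i0 == 1) ||
  ((v 0 i0 == 0) && ((v 0 i1 == 1) || ((v 0 i1 == 0) && (v 0 i2 == 1)))).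

(* points of PG(2,F) (also used for lines, via dual coordinates) *)
Definition point := {v : 'rV[F]_3 | normalized v}.

Definition incident (P L : point) : bool :=
  \sum_(i < 3) (val P) 0 i * (val L) 0 i == 0.

(* U is a unital of PG(2,q^2) (here F is meant to have q^2 elements) *)
Definition is_unital (q : nat) (U : {set point}) : Prop :=
  #|U| = (q ^ 3 + 1)%N /\
  forall L : point,
    #|[set P in U | incident P L]| = 1%N \/
    #|[set P in U | incident P L]| = q.+1.

Definition conjq (q : nat) (x : F) : F := x ^+ q.

Definition hermitian_matrix (q : nat) (A : 'M[F]_3) : bool :=
  (A^T == map_mx (conjq q) A) && (A \in unitmx).

Definition herm_value (q : nat) (A : 'M[F]_3) (v : 'rV[F]_3) : F :=
  (v *m A *m (map_mx (conjq q) v)^T) 0 0.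

Definition is_hermitian_unital (q : nat) (H : {set point}) : Prop :=
  exists A : 'M[F]_3, hermitian_matrix q A /\
    H = [set P : point | herm_value q A (val P) == 0].

Definition BM_set (q : nat) (alpha beta : F) : {set point} :=
  [set P : point |
    (val P == row3 0 0 1) ||
    [exists y : F, exists r : F,
       (r ^+ q == r) &&
       (val P == row3 1 y (alpha * y ^+ 2 + beta * y ^+ q.+1 + r))]].

Definition proj_image (M : 'M[F]_3) (S : {set point}) : {set point} :=
  [set P : point | [exists Q in S, exists c : F,
      (c != 0) && (val P == c *: (val Q *m M))]].

Definition is_BM_unital (q : nat) (U : {set point}) : Prop :=
  exists (alpha beta : F) (M : 'M[F]_3),
    M \in unitmx /\ is_unital q (BM_set q alpha beta) /\
    U = proj_image M (BM_set q alpha beta).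

End PG2.

(* Main.v *)
Require Import Defs.
From HB Require Import structures.
From mathcomp Require Import all_boot all_order all_algebra all_fingroup all_field.
From mathcomp Require Import zify ring qpoly cyclic.

(* Lift F = GF(q^2) to a Galois ring W of characteristic p^K, with Teichmueller
   representatives tau, and put N = q^2 - 1.  For a nonzero value h of a Hermitian
   form h^(q-1) = 1, so that the indicator of h <> 0 is the E-th power,
   E = (q-1) p^K, of the sum of the tau(A_ij x_i x_j^q).  Expanding this power
   expresses the number of points of U off H through monomial sums over U, with
   multinomial coefficients whose p-adic valuations are bounded below by base p
   digit sums (Legendre).

   For a general unital U, the only input is that q divides the number of points
   of U off any given line.  Summing this over all lines L, weighted by a monomial
   in the coordinates of L, gives q | g S where S is a monomial sum over U and g is
   a Jacobi sum.  As g times the Jacobi sum g' of the inverse characters is q^2 N^2,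
   the digit sum bound on g' gives p^k | S for a certain k.  If v is the valuation
   of the multinomial coefficient in front of S, one finds k >= t - 2 v, and
   v + max(0, t - 2 v) >= t / 2.

   For a Buekenhout-Metz unital, the Hermitian form evaluated at
   (1, y, alpha y^2 + beta y^(q+1) + r) has degree at most 4 for the weights 1 of y
   (which counts as two variables over GF(q)) and 2 of r, which add up to 4.  A
   weighted form of the Ax-Katz theorem shows that modulo q its number of zeros
   only depends on its part of degree 4, a scalar multiple of the norm of
   alpha y^2 + beta y^(q+1) + r; this vanishes only at y = r = 0 unless the scalar
   is 0.  The last step needs q > 2; for q = 2 the first congruence suffices. *)

Set Implicit Arguments. Unset Strict Implicit. Unset Printing Implicit Defensive.
Import GRing.Theory.

(** * Digit sums and multinomial coefficients *)

Section Digits.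
Variable p : nat.
Hypothesis p_pr : prime p.

Lemma logn_fact_widen m n : n <= m ->
  logn p n`! = \sum_(1 <= k < m.+1) n %/ p ^ k.
Proof.
move=> le_nm; rewrite logn_fact // (@big_cat_nat _ _ _ n.+1 1 m.+1) //=.
rewrite [X in _ = _ + X]big1_seq ?addn0 // => k /andP[_].
rewrite mem_index_iota => /andP[lt_nk _]; apply: divn_small.
by apply: ltn_trans lt_nk (ltn_expl k (prime_gt1 p_pr)).
Qed.

(** Only the multiples [p, 2p, ..., e p] contribute: one step of Legendre's recursion, which drops
    the last digit [d]. *)
Lemma logn_fact_digit d e : d < p -> logn p (d + p * e)`! = e + logn p e`!.
Proof.
move=> ltdp; have p_gt0 := prime_gt0 p_pr.
have divE : (d + p * e) %/ p = e.
  by rewrite addnC mulnC divnMDl // divn_small ?addn0.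
case: (posnP (d + p * e)) => [s0 | s_gt0].
  have e0 : e = 0 by rewrite -divE s0 div0n.
  by rewrite s0 e0 fact0 logn1.
have lt_es : e < d + p * e.
  by rewrite -{1}divE ltn_Pdiv ?prime_gt1.
move: s_gt0 lt_es divE; case: (d + p * e) => // s _ lt_es divE.
rewrite (logn_fact_widen (leqnn _)) (@logn_fact_widen s) //.
rewrite big_add1 [LHS]big_nat_recl //= expn1 divE; congr (_ + _).
by rewrite big_add1 /=; apply: eq_bigr => i _; rewrite expnS divnMA divE.
Qed.

(** Legendre's formula [(p - 1) v(m!) = m - s(m)] for [m = (p^a - 1) p^n], whose base [p] digits are
    [a] times [p - 1] followed by zeros, so that [s(m) = a (p - 1)]. *)
Lemma logn_fact_pred_expn a n :
  (p.-1 * (logn p ((p ^ a).-1 * p ^ n)`! + a) = (p ^ a).-1 * p ^ n)%N.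
Proof.
have p_gt0 := prime_gt0 p_pr.
elim: n => [|n IHn]; last first.
  rewrite expnS mulnCA -[X in (X)`!]add0n logn_fact_digit // -addnA mulnDr IHn.
  by rewrite addnC -mulSn prednK.
rewrite expn0 muln1; elim: a => [|a IHa]; first by rewrite fact0 logn1 muln0.
have -> : (p ^ a.+1).-1 = (p.-1 + p * (p ^ a).-1)%N.
  rewrite expnS -(prednK (_ : 0 < p ^ a)) ?expn_gt0 ?p_gt0 // mulnS /=.
  by rewrite -{1}(prednK p_gt0).
rewrite logn_fact_digit ?prednK //.
rewrite (_ : (_ + a.+1)%N = ((p ^ a).-1 + (logn p (p ^ a).-1`! + a) + 1)%N); last lia.
rewrite mulnDr [X in X + _]mulnDr IHa muln1.
by rewrite addnC [X in _ + X]addnC -mulSn prednK.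
Qed.

(* Representative of x mod N in {1, ..., N}, except that 0 represents itself:
   the exponents x and red N x then define the same function x |-> x ^+ _ on
   the field with N + 1 elements. *)
Definition red (N x : nat) : nat := if x == 0 then 0 else (x.-1 %% N).+1.

Lemma red_modn N x : red N x = x %[mod N].
Proof. by case: x => //= x; rewrite /red /= -addn1 modnDml addn1. Qed.

Lemma red_le N x z : 0 < N -> x = z %[mod N] -> (x != 0 -> z != 0) -> red N x <= z.
Proof.
move=> N_gt0; case: x => // x exz /(_ isT); case: z exz => // z exz _.
rewrite /red /= ltnS; move/eqP: exz; rewrite -(addn1 x) -(addn1 z) eqn_modDr.
by move/eqP->; apply: leq_mod.
Qed.

Lemma red_gt0 N x : (0 < red N x) = (0 < x).
Proof. by case: x. Qed.

Lemma red_dvd N x : 0 < N -> 0 < x -> N %| x -> red N x = N.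
Proof.
move=> N_gt0; case: x => // x _ dvdx; rewrite /red /=.
have := ltn_pmod x N_gt0; rewrite leq_eqVlt => /orP[/eqP-> //|lt].
move: dvdx; rewrite /dvdn -addn1 -modnDml addn1 modn_small //.
Qed.

Variable T : nat.
Hypothesis T_gt0 : 0 < T.
Let N := (p ^ T).-1.

Let N_gt0 : 0 < N.
Proof.
rewrite /N -ltnS prednK ?expn_gt0 ?prime_gt0 //.
by rewrite -{1}(expn0 p) ltn_exp2l ?prime_gt1.
Qed.

Let pTE : p ^ T = N.+1.
Proof. by rewrite /N prednK ?expn_gt0 ?prime_gt0. Qed.

(* (p - 1) * cyc e / N is the base p digit sum of red N e. *)
Definition cyc (e : nat) : nat := \sum_(l < T) red (p ^ T).-1 (p ^ l * e).

(** Subadditivity of digit sums. For each [l], the combination of the [red N (p ^ l * e j)] is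
    congruent to [p ^ l * x] and vanishes only if [x] does, so the minimality in [red_le] applies
    term by term. *)
Lemma cyc_le (J : finType) (e : J -> nat) (w : J -> nat) x :
  x = \sum_j w j * e j %[mod N] ->
  (0 < x -> 0 < \sum_j w j * e j) ->
  cyc x <= \sum_j w j * cyc (e j).
Proof.
move=> xE x_gt0; rewrite /cyc.
under eq_bigr do rewrite big_distrr /=.
rewrite exchange_big /=; apply: leq_sum => l _; apply: red_le => //.
  rewrite -modnMmr xE modnMmr big_distrr /= -modn_summ -[in RHS]modn_summ.
  congr (_ %% _)%N; apply: eq_bigr => j _.
  by rewrite -[in RHS]modnMmr red_modn modnMmr mulnCA.
rewrite -!lt0n muln_gt0 => /andP[pl_gt0 /x_gt0].
rewrite lt0n sum_nat_eq0 negb_forall => /existsP[j].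
rewrite implyTb -lt0n muln_gt0 => /andP[w_gt0 e_gt0].
rewrite lt0n sum_nat_eq0 negb_forall; apply/existsP; exists j.
by rewrite implyTb -lt0n muln_gt0 w_gt0 red_gt0 muln_gt0 pl_gt0.
Qed.

Lemma red_cycle e : red N (p ^ T * e) = red N e.
Proof.
have H : (p ^ T * e = e %[mod N])%N by rewrite pTE mulSn addnC mulnC modnMDl.
apply/eqP; rewrite eqn_leq; apply/andP; split; apply: red_le => //.
- by rewrite red_modn.
- by rewrite muln_eq0 negb_or -!lt0n red_gt0 => /andP[].
- by rewrite red_modn.
by rewrite -!lt0n red_gt0 muln_gt0 pTE.
Qed.

(** Since [p ^ T] is 1 modulo [N], multiplication by [p] permutes the terms of the sum cyclically,
    just as it rotates the digits. *)
Lemma cycMp e : cyc (p * e) = cyc e.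
Proof.
pose f l := red N (p ^ l * e); rewrite /cyc (eq_bigr (fun l : 'I_T => f l.+1)).
  have fT : f T = f 0 by rewrite /f red_cycle mul1n.
  rewrite -/N -[RHS]/(\sum_(l < T) f l).
  have := big_ord_recr (idx := 0) (op := addn) T (fun l => f l).
  by rewrite big_ord_recl /= fT [RHS]addnC => /addnI.
by move=> l _; rewrite /f mulnA -expnSr.
Qed.

Lemma cycXp i e : cyc (p ^ i * e) = cyc e.
Proof.
by elim: i => [|i IHi]; rewrite ?expn0 ?mul1n // expnS -mulnA cycMp.
Qed.

Lemma cyc1 : (p.-1 * cyc 1 = N)%N.
Proof.
rewrite /cyc /N [RHS]predn_exp; congr (_ * _)%N; apply: eq_bigr => i _.
rewrite muln1 /red eqn0Ngt expn_gt0 prime_gt0 //=.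
rewrite modn_small ?prednK ?expn_gt0 ?prime_gt0 //.
rewrite -ltnS !prednK ?expn_gt0 ?prime_gt0 //.
by rewrite ltn_exp2l ?prime_gt1.
Qed.

Lemma cyc_dvd x : 0 < x -> N %| x -> cyc x = (T * N)%N.
Proof.
move=> x_gt0 Nx; rewrite /cyc; under eq_bigr => l _.
  rewrite red_dvd ?muln_gt0 ?expn_gt0 ?(prime_gt0 p_pr) // ?dvdn_mull //.
  over.
by rewrite sum_nat_const card_ord.
Qed.

(** Digits of opposite classes are complementary: each [red N (p ^ l * x) + red N (p ^ l * y)] is a
    positive multiple of [N] below [2 N], hence equal to [N]. *)
Lemma cyc_opp x y : ~~ (N %| x) -> N %| x + y -> 0 < y -> (cyc x + cyc y = T * N)%N.
Proof.
move=> Nx Nxy y_gt0; rewrite /cyc -big_split /= -[in RHS](card_ord T).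
rewrite -sum_nat_const; apply: eq_bigr => l _; rewrite -/N.
have pl : coprime N (p ^ l).
  rewrite coprime_sym coprimeXl // -(coprime_pexpl _ _ T_gt0) pTE.
  exact: coprimeSn.
have red_ltN z : red N z <= N by case: z => // z; rewrite /red /= ltn_pmod.
have red_ltx : red N (p ^ l * x) < N.
  rewrite ltn_neqAle red_ltN andbT; apply: contra Nx => /eqP redE.
  rewrite -(Gauss_dvdr _ pl) /dvdn -red_modn redE modnn //.
have dvd_red : N %| red N (p ^ l * x) + red N (p ^ l * y).
  rewrite /dvdn -modnDm !red_modn modnDm -mulnDr.
  by rewrite -/(dvdn _ _) dvdn_mull.
have red_y : 0 < red N (p ^ l * y).
  by rewrite red_gt0 muln_gt0 expn_gt0 prime_gt0.
case/dvdnP: dvd_red => [[|[|k]] //]; first by lia.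
  by rewrite mul1n.
by have := red_ltN (p ^ l * y)%N; rewrite mulSn mulSn; lia.
Qed.

(** In terms of digit sums this is [s(red N e) <= s(e)], with [s(e) = e - (p - 1) v(e!)] by
    Legendre. The induction strips one digit at a time. *)
Lemma cyc_fact_le e : p.-1 * cyc e + N * (p.-1 * logn p e`!) <= N * e.
Proof.
elim/ltn_ind: e => e IH; have p_gt1 := prime_gt1 p_pr; have p_gt0 := prime_gt0 p_pr.
case: (posnP e) => [-> | e_gt0].
  rewrite fact0 logn1 !muln0 addn0 /cyc big1 ?muln0 // => i _.
  by rewrite muln0.
have eE : e = (e %% p + p * (e %/ p))%N by rewrite {1}(divn_eq e p) addnC mulnC.
set d := (e %% p)%N in eE; set e' := (e %/ p)%N in eE.
have lt_d : d < p by rewrite ltn_mod.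
have /IH IHe' : e' < e by rewrite ltn_Pdiv.
rewrite [in logn _ _]eE logn_fact_digit //.
(* Subadditivity for [e = d * 1 + 1 * (p * e')], the two terms being indexed by the booleans. *)
have : cyc e <= d * cyc 1 + cyc e'.
  have := @cyc_le bool (fun b => if b then 1 else p * e')%N (fun b => if b then d else 1) e.
  rewrite !big_bool /= muln1 !mul1n -eE cycMp; exact.
move=> /(leq_mul (leqnn p.-1)); rewrite mulnDr mulnCA cyc1 => le1.
have pe : (p * e' = p.-1 * e' + e')%N by rewrite -{1}(prednK p_gt0) mulSn addnC.
rewrite [X in _ <= _ * X]eE pe; move: le1 IHe'; rewrite !mulnDr [(d * N)%N]mulnC.
by clear; lia.
Qed.

(* This plays the role of Stickelberger's theorem on the valuations of Gauss sums. *)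
Lemma logn_multinomial (J : finType) (e : J -> nat) c a n :
  \sum_j e j = ((p ^ a).-1 * p ^ n)%N ->
  (c * \prod_j (e j)`!)%N = ((p ^ a).-1 * p ^ n)`! ->
  \sum_j cyc (e j) <= N * logn p c + a * N.
Proof.
move=> sum_e cE; have p1 : 0 < p.-1 by rewrite -ltnS prednK ?prime_gt1 ?prime_gt0.
have c_gt0 : 0 < c by have := fact_gt0 ((p ^ a).-1 * p ^ n); rewrite -cE muln_gt0 => /andP[].
have lognE : logn p c + \sum_j logn p (e j)`! = logn p ((p ^ a).-1 * p ^ n)`!.
  have H (s : seq J) : 0 < \prod_(j <- s) (e j)`! /\
     logn p (\prod_(j <- s) (e j)`!) = \sum_(j <- s) logn p (e j)`!.
    elim: s => [|j s [IH1 IH2]]; first by rewrite !big_nil logn1.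
    by rewrite !big_cons muln_gt0 fact_gt0 IH1 lognM ?fact_gt0 // IH2.
  by rewrite -cE lognM //; have [h1 h2] := H (index_enum J); rewrite ?h2.
have leS : p.-1 * \sum_j cyc (e j) + N * (p.-1 * \sum_j logn p (e j)`!)
            <= N * \sum_j e j.
  rewrite !big_distrr /= -big_split /=; apply: leq_sum => j _.
  exact: cyc_fact_le.
have := logn_fact_pred_expn a n; rewrite -lognE -sum_e => EE.
rewrite -(leq_pmul2l p1); move: leS; rewrite -EE.
move: (\sum_j cyc _) (\sum_j logn _ _) (logn p c) => x y z.
by rewrite !mulnDr [(p.-1 * (N * z))%N]mulnCA; move: (p.-1) => k; lia.
Qed.

End Digits.

(** * Galois rings *)

Local Open Scope ring_scope.

(* An unramified lift of F to characteristic p ^ K. *)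
Record galois_ring (F : fieldType) (p K : nat) := GaloisRing {
  gr_ring :> comNzRingType;
  gr_red : {rmorphism gr_ring -> F};
  gr_lift : F -> gr_ring;
  gr_liftK : cancel gr_lift gr_red;
  gr_ker : forall w, gr_red w = 0 -> exists w', w = p%:R * w';
  gr_torsion : forall i (w : gr_ring), (i <= K)%N -> p%:R ^+ i * w = 0 ->
    exists w' : gr_ring, w = p%:R ^+ (K - i) * w';
  gr_natr_eq0 : forall n, n%:R = 0 :> gr_ring -> (p ^ K %| n)%N;
  gr_pK : p%:R ^+ K = 0 :> gr_ring
}.

Section GaloisRing.
Variables (F : finFieldType) (p K : nat).
Hypotheses (pF : p \in [pchar F]) (K_gt0 : (0 < K)%N).

Let p_pr : prime p := pcharf_prime pF.

Let pK_gt1 : (1 < p ^ K)%N.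
Proof. by rewrite -(expn0 p) ltn_exp2l ?prime_gt1. Qed.

Let Z := 'Z_(p ^ K).

Definition zmod_red (x : Z) : F := (x : nat)%:R.

Let natr_modp m : (m %% p ^ K)%:R = m%:R :> F.
Proof.
rewrite [in RHS](divn_eq m (p ^ K)) natrD natrM natrX (pcharf0 pF).
by rewrite expr0n gtn_eqF // mulr0 add0r.
Qed.

Let zmod_red_nat m : zmod_red m%:R = m%:R.
Proof. by rewrite /zmod_red val_Zp_nat. Qed.

Fact zmod_red_is_zmod_morphism : zmod_morphism zmod_red.
Proof.
suff D : {morph zmod_red : x y / x + y}.
  move=> x y; apply/eqP; rewrite eq_sym subr_eq -D subrK //.
by move=> x y; rewrite -(natr_Zp x) -(natr_Zp y) -natrD !zmod_red_nat natrD.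
Qed.

Fact zmod_red_is_monoid_morphism : monoid_morphism zmod_red.
Proof.
split; first by rewrite -[1]/(1%:R) zmod_red_nat.
by move=> x y; rewrite -(natr_Zp x) -(natr_Zp y) -natrM !zmod_red_nat natrM.
Qed.

HB.instance Definition _ := GRing.isZmodMorphism.Build Z F zmod_red
  zmod_red_is_zmod_morphism.
HB.instance Definition _ := GRing.isMonoidMorphism.Build Z F zmod_red
  zmod_red_is_monoid_morphism.

Let natZ_eq0 m : (m%:R == 0 :> Z) = (p ^ K %| m)%N.
Proof. by rewrite -val_eqE /= val_Zp_nat. Qed.

Let Z_ker (x : Z) : zmod_red x = 0 -> x = p%:R * ((x : nat) %/ p)%:R.
Proof.
move=> x0; rewrite -natrM mulnC divnK ?natr_Zp //.
by rewrite (dvdn_pcharf pF); apply/eqP.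
Qed.

Let Z_torsion i (x : Z) : (i <= K)%N -> p%:R ^+ i * x = 0 ->
  x = p%:R ^+ (K - i) * ((x : nat) %/ p ^ (K - i))%:R.
Proof.
move=> leiK /eqP x0; rewrite -natrX -natrM mulnC divnK ?natr_Zp //.
move: x0; rewrite -{1}(natr_Zp x) -natrX -natrM natZ_eq0.
by rewrite -{1}(subnKC leiK) expnD dvdn_pmul2l ?expn_gt0 ?prime_gt0.
Qed.

Let Z_unit (x : Z) : zmod_red x != 0 -> x \is a GRing.unit.
Proof.
move=> x0; rewrite -(natr_Zp x) unitZpE // coprime_sym coprimeXr //.
by rewrite coprime_sym prime_coprime // (dvdn_pcharf pF).
Qed.

Lemma fin_field_generator : exists th : F, forall x, x != 0 -> exists i, x = th ^+ i.
Proof.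
have /cyclicP[u uE] := field_unit_group_cyclic [set: {unit F}]%G.
exists (val u) => x x0; have xU : x \is a GRing.unit by rewrite unitfE.
have : FinRing.Unit xU \in <[u]>%g by rewrite -uE inE.
by case/cycleP=> i /(congr1 val); rewrite FinRing.val_unitX; exists i.
Qed.

(** * The quotient of (Z/p^K)[X] by a lifted minimal polynomial *)

Section Quotient.
Variables (th : F) (g : {poly Z}).
Hypotheses (th_gen : forall x, x != 0 -> exists i, x = th ^+ i)
  (g_monic : g \is monic) (g_root : (map_poly zmod_red g).[th] = 0)
  (g_min : forall h, h \is monic -> (map_poly zmod_red h).[th] = 0 ->
             (size g <= size h)%N).

Let g_size : (1 < size g)%N.
Proof.
rewrite ltn_neqAle size_poly_gt0 monic_neq0 // andbT eq_sym.
apply/negP => /size_poly1P[c c0 gE].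
have := lead_coefC c; rewrite -gE (monicP g_monic) => c1.
by move: g_root; rewrite gE -c1 rmorph1 hornerC => /eqP; rewrite oner_eq0.
Qed.

(** Having least degree among the monic polynomials whose reduction vanishes at [th], [g] lifts the
    minimal polynomial of [th] over GF(p). *)
Let W := {poly %/ g}.

(** [{poly %/ g}] is the quotient by [mk_monic g], which falls back to a default polynomial unless
    [g] is monic and non-constant. *)
Let mkE : mk_monic g = g :> {poly Z}.
Proof. by rewrite /mk_monic g_size g_monic. Qed.

Let wsize (w : W) : (size (w : {poly Z}) < size g)%N.
Proof.
exact: leq_trans (size_mk_monic w) (eq_leq (congr1 (fun h : {poly Z} => size h) mkE)).
Qed.

Definition qpoly_red (w : W) : F := (map_poly zmod_red (w : {poly Z})).[th].

Let red_mod (h : {poly Z}) :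
  (map_poly zmod_red (Pdiv.CommonRing.rmodp h (mk_monic g))).[th] = (map_poly zmod_red h).[th].
Proof.
rewrite mkE [in RHS](Pdiv.RingMonic.rdivp_eq g_monic h) rmorphD rmorphM hornerD hornerM.
by rewrite /= g_root mulr0 add0r.
Qed.

Fact qpoly_red_is_zmod_morphism : zmod_morphism qpoly_red.
Proof. by move=> x y; rewrite /qpoly_red /= rmorphB hornerD hornerN. Qed.

Fact qpoly_red_is_monoid_morphism : monoid_morphism qpoly_red.
Proof.
split; first by rewrite /qpoly_red /= rmorph1 hornerC.
by move=> x y; rewrite /qpoly_red /= red_mod rmorphM hornerM.
Qed.

HB.instance Definition _ := GRing.isZmodMorphism.Build W F qpoly_red
  qpoly_red_is_zmod_morphism.
HB.instance Definition _ := GRing.isMonoidMorphism.Build W F qpoly_red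
  qpoly_red_is_monoid_morphism.

(** Otherwise the reduction of [w] has a nonzero leading coefficient, in degree [j]. Truncating [w]
    there and dividing by its [j]-th coefficient, a unit, gives a monic polynomial shorter than [g]
    whose reduction vanishes at [th]. *)
Let red_coef (w : {poly Z}) : (size w < size g)%N ->
  (map_poly zmod_red w).[th] = 0 -> forall i, zmod_red w`_i = 0.
Proof.
move=> sw w0 i; apply/eqP; apply: contraT => wi.
have : map_poly zmod_red w != 0.
  by apply: contra wi => /eqP/(congr1 (fun h : {poly F} => h`_i)); rewrite coef_map coef0 /= => ->.
rewrite -lead_coef_eq0 lead_coefE coef_map /=; set j := (size _).-1 => wj.
have wj_unit := Z_unit wj.
pose h := (w`_j)^-1 *: take_poly j.+1 w.
have sh : (size h <= j.+1)%N.
  by apply: leq_trans (size_scale_leq _ _) (size_take_poly _ _).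
have hj : h`_j = 1 by rewrite coefZ coef_take_poly ltnSn mulVr.
have h_size : size h = j.+1.
  apply/eqP; rewrite eqn_leq sh /=; rewrite ltnNge; apply/negP => /leq_sizeP/(_ j (leqnn _)).
  by rewrite hj => /eqP; rewrite oner_eq0.
have h_monic : h \is monic by rewrite monicE lead_coefE h_size /= hj.
have h0 : (map_poly zmod_red h).[th] = 0.
  rewrite map_polyZ hornerZ /= (_ : map_poly _ _ = map_poly zmod_red w) ?w0 ?mulr0 //.
  apply/polyP => k; rewrite !coef_map /= coef_take_poly; case: ltnP => // lejk.
  rewrite raddf0 -coef_map nth_default //.
  apply: leq_trans lejk; rewrite /j; exact: leqSpred.
have := g_min h_monic h0; rewrite h_size leqNgt => /negP[].
apply: leq_ltn_trans sw.
have : (j < size w)%N; last by [].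
rewrite ltnNge; apply: contra wj => lewj.
by rewrite nth_default // raddf0.
Qed.

Let poly_of_natr (m : nat) (w : W) : ((m%:R * w : W) : {poly Z}) = m%:R *: (w : {poly Z}).
Proof. by rewrite mulr_natl -scaler_nat /=. Qed.

Let poly_lift (a : nat) (f : Z -> Z) (w : W) :
  (forall i, w`_i = a%:R * f w`_i) -> exists w' : W, w = a%:R * w'.
Proof.
move=> H; exists (in_qpoly g (\poly_(i < (size g).-1) f w`_i)).
apply/npolyP => i; rewrite poly_of_natr.
rewrite coefZ in_qpoly_small ?mkE; last first.
  by apply: leq_ltn_trans (size_poly _ _) _; rewrite mkE ltn_predL ltnW.
rewrite coef_poly; case: ltnP => [_|le]; first exact: H.
rewrite mulr0 nth_default //.
by apply: leq_trans le; rewrite -ltnS prednK ?(ltnW g_size).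
Qed.

Lemma qpoly_galois_ring : inhabited (galois_ring F p K).
Proof.
(* A nonzero [x] is a power of the generator [th], and the class of ['X] reduces to [th]. *)
have liftX (x : F) : exists w : W, qpoly_red w == x.
  have [-> | /th_gen[i ->]] := eqVneq x 0; first by exists 0; rewrite raddf0.
  by exists (in_qpoly g 'X ^+ i);
     rewrite rmorphXn /= /qpoly_red /in_qpoly /= red_mod map_polyX hornerX.
pose lift x := xchoose (liftX x).
constructor; apply: (@GaloisRing F p K W qpoly_red lift).
- by move=> x; apply/eqP; apply: (xchooseP (liftX x)).
- move=> w w0; apply: (@poly_lift p (fun x => ((x : nat) %/ p)%:R)) => i.
  by apply: Z_ker; apply: red_coef.
- move=> i w leiK pw0.
  have [|w' ->] := @poly_lift (p ^ (K - i))%N (fun x => ((x : nat) %/ p ^ (K - i))%:R) w.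
    move=> j; rewrite natrX; apply: Z_torsion => //.
    move/(congr1 (fun v : W => (v : {poly Z})`_j)): pw0.
    by rewrite -natrX poly_of_natr coefZ natrX coef0.
  by exists w'; rewrite natrX.
- move=> m /(congr1 (fun v : W => (v : {poly Z})`_0)).
  rewrite -[m%:R]mulr1 poly_of_natr coefZ coef0 /= coefC eqxx mulr1.
  by move/eqP; rewrite natZ_eq0.
rewrite -natrX -[_%:R]mulr1; apply/npolyP => i; rewrite poly_of_natr.
by rewrite coefZ coef0 (eqP (_ : (p ^ K)%:R == 0)) ?mul0r // natZ_eq0.
Qed.

End Quotient.

Lemma galois_ring_exists : inhabited (galois_ring F p K).
Proof.
have [th th_gen] := fin_field_generator.
pose good (h : {poly Z}) := (h \is monic) && ((map_poly zmod_red h).[th] == 0).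
(* Polynomials of size at most [m] form the finite type [{poly_m Z}], which makes the statement
   minimised by [ex_minnP] boolean. *)
have good_ex : exists m, [exists h : {poly_m Z}, good h && (size (h : {poly Z}) == m)].
  pose h : {poly Z} := 'X^#|F| - 'X.
  have cF : (1 < #|F|)%N by exact: finNzRing_gt1.
  have sh : size h = #|F|.+1.
    by rewrite size_polyDl ?size_polyXn // size_polyN size_polyX.
  exists (size h); apply/existsP; exists (npolyp (size h) h).
  rewrite npolypK // eqxx andbT; apply/andP; split.
    rewrite monicE lead_coefDl ?lead_coefXn //.
    by rewrite size_polyN size_polyX size_polyXn.
  rewrite rmorphB /= map_polyXn map_polyX hornerD hornerN hornerXn hornerX.
  by rewrite expf_card subrr.
case: (ex_minnP good_ex) => m /existsP[[h sh] /= /andP[/andP[h_monic /eqP h_root] /eqP hm]] m_min.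
apply: (qpoly_galois_ring th_gen h_monic h_root) => f f_monic f_root.
rewrite hm; apply: m_min; apply/existsP; exists (npolyp (size f) f).
by rewrite npolypK // eqxx andbT /good f_monic f_root eqxx.
Qed.

End GaloisRing.

(** * Teichmueller representatives *)

Section Multinomial.
Variables (R : comPzRingType) (J X : finType) (x : X -> J -> R).

(* The coefficient c below is E! / \prod_j (e j)!; it is characterised through
   the product so that its valuation can be computed without division. *)
Lemma sum_expr_ind (Z : R -> Prop) (y : X -> R) E :
  Z 0 -> (forall u v, Z u -> Z v -> Z (u + v)) ->
  (forall (e : J -> nat) c, (\sum_j e j)%N = E -> (c * \prod_j (e j)`!)%N = E`! ->
     Z (c%:R * \sum_P y P * \prod_j x P j ^+ e j)) ->
  Z (\sum_P y P * (\sum_j x P j) ^+ E).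
Proof.
move=> Z0 ZD.
suff H (s : seq J) : uniq s -> forall (z : X -> R) n,
    (forall (e : J -> nat) c, (\sum_(j <- s) e j)%N = n ->
      (c * \prod_(j <- s) (e j)`!)%N = n`! ->
      Z (c%:R * \sum_P z P * \prod_(j <- s) x P j ^+ e j)) ->
    Z (\sum_P z P * (\sum_(j <- s) x P j) ^+ n).
  by apply: H; apply: index_enum_uniq.
elim: s => [_ | j s IHs /andP[js s_uniq]] z n ZE.
  under eq_bigr do rewrite big_nil.
  have [n0 | n_gt0] := posnP n; last first.
    by rewrite big1 // => P _; rewrite expr0n gtn_eqF // mulr0.
  have := ZE (fun=> 0%N) 1%N; rewrite !big_nil n0 mul1r => /(_ erefl erefl).
  by congr Z; apply: eq_bigr => P _; rewrite big_nil.
have -> : \sum_P z P * (\sum_(k <- j :: s) x P k) ^+ n =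
    \sum_(i < n.+1) \sum_P (z P * x P j ^+ (n - i) * 'C(n, i)%:R) *
                          (\sum_(k <- s) x P k) ^+ i.
  rewrite exchange_big; apply: eq_bigr => P _.
  rewrite big_cons exprDn big_distrr; apply: eq_bigr => i _ /=.
  by rewrite -mulr_natr; ring.
apply: big_ind => // i _; apply: (IHs s_uniq) => e c sum_e cE.
have leiN : (i <= n)%N by rewrite -ltnS.
(* A monomial of degree [i] in the remaining variables is completed by the power [n - i] of [x P j],
   and [c] is multiplied by a binomial coefficient. *)
pose e' k := if k == j then (n - i)%N else e k.
have e's k : k \in s -> e' k = e k.
  by move=> ks; rewrite /e'; case: eqP => // kj; rewrite -kj ks in js.
have := ZE e' (c * 'C(n, i))%N; rewrite !big_cons.
rewrite (eq_big_seq _ e's) sum_e.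
rewrite (eq_big_seq (fun k => (e k)`!)); last by move=> k /e's ->.
rewrite {1 2}/e' eqxx subnK // natrM => /(_ erefl).
set P' := (\prod_(k <- s) _)%N in cE *.
have -> : (c * 'C(n, i) * ((n - i)`! * P') = n`!)%N.
  by rewrite -(bin_fact leiN) -cE; ring.
move/(_ erefl); congr Z; rewrite -mulrA big_distrr; congr (_ * _).
apply: eq_bigr => P _; rewrite big_cons {1}/e' eqxx.
rewrite (eq_big_seq (fun k => x P k ^+ e k)) /=; last by move=> k /e's ->.
by ring.
Qed.

End Multinomial.

(** * Divisibility by powers of [p] and Teichmueller lifts *)

Section Teichmuller.
Variables (p K : nat) (F : finFieldType) (W : galois_ring F p K).
Variable T : nat.
Hypotheses (p_pr : prime p) (T_gt0 : (0 < T)%N) (cardF : #|F| = (p ^ T)%N).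

Local Notation red := (gr_red W).
Let N := (p ^ T).-1.

Lemma pcharF : p \in [pchar F].
Proof. exact: (card_finPcharP cardF). Qed.

Let pTE : (p ^ T = N.+1)%N.
Proof. by rewrite /N prednK ?expn_gt0 ?prime_gt0. Qed.

Definition pdiv (k : nat) (w : W) : Prop := exists w' : W, w = p%:R ^+ k * w'.

Lemma pdiv0 k : pdiv k 0.
Proof. by exists 0; rewrite mulr0. Qed.

Lemma pdivD k u v : pdiv k u -> pdiv k v -> pdiv k (u + v).
Proof. by case=> u' -> [v' ->]; exists (u' + v'); rewrite mulrDr. Qed.

Lemma pdiv_sum k I (r : seq I) (P : pred I) (f : I -> W) :
  (forall i, P i -> pdiv k (f i)) -> pdiv k (\sum_(i <- r | P i) f i).
Proof. exact: (big_ind _ (pdiv0 k) (@pdivD k)). Qed.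

Lemma pdivM k l u v : pdiv k u -> pdiv l v -> pdiv (k + l) (u * v).
Proof. by case=> u' -> [v' ->]; exists (u' * v'); rewrite exprD; ring. Qed.

Lemma pdiv_any w : pdiv 0 w.
Proof. by exists w; rewrite expr0 mul1r. Qed.

Lemma pdivMl k u v : pdiv k v -> pdiv k (u * v).
Proof. by move=> v_k; rewrite -[k]add0n; apply: pdivM => //; apply: pdiv_any. Qed.

Lemma pdivMr k u v : pdiv k u -> pdiv k (u * v).
Proof. by rewrite mulrC; apply: pdivMl. Qed.

Lemma pdiv_leq k l w : (l <= k)%N -> pdiv k w -> pdiv l w.
Proof.
by move=> /subnKC <- [w' ->]; exists (p%:R ^+ (k - l) * w'); rewrite exprD mulrA.
Qed.

Lemma pdiv_nat k n : (p ^ k %| n)%N -> pdiv k n%:R.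
Proof. by case/dvdnP=> m ->; exists m%:R; rewrite natrM natrX mulrC. Qed.

Lemma pdiv_pK k w : (K <= k)%N -> pdiv k w -> w = 0.
Proof.
by move=> leKk [w' ->]; rewrite -(subnKC leKk) exprD gr_pK !mul0r.
Qed.

(** Cancelling [p ^ i] leaves an ambiguity in its annihilator [p ^ (K - i) W], which lies in
    [p ^ k W] when [i + k <= K]. *)
Lemma pdiv_cancel i k w : (i + k <= K)%N -> pdiv (i + k) (p%:R ^+ i * w) -> pdiv k w.
Proof.
move=> le_ik [w' /eqP]; rewrite exprD -mulrA -subr_eq0 -mulrBr => /eqP pi0.
have /(gr_torsion (leq_trans (leq_addr _ _) le_ik))[v vE] := pi0.
rewrite -[w](subrK (p%:R ^+ k * w')) vE; apply: pdivD; last by exists w'.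
by apply: (@pdiv_leq (K - i)); [rewrite leq_subRL // (leq_trans (leq_addr _ _) le_ik) | exists v].
Qed.

(** After multiplication by [p ^ (K - k)] the hypothesis says that [p ^ (K - k) * n] vanishes in
    [W], whose characteristic is [p ^ K]. *)
Lemma pdiv_natE k n : (k <= K)%N -> pdiv k n%:R -> (p ^ k %| n)%N.
Proof.
move=> lekK [w /(congr1 (fun w => p%:R ^+ (K - k) * w))].
rewrite mulrA -exprD subnK // gr_pK mul0r -natrX -natrM => /gr_natr_eq0.
by rewrite -{1}(subnK lekK) expnD dvdn_pmul2l ?expn_gt0 ?prime_gt0.
Qed.

(** In the factorisation of a difference of [p]-th powers by [a - b], the cofactor has [p] terms
    with the same reduction, so it contributes one more factor [p]. *)
Lemma expr_pX_congr n (a b : W) :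
  red a = red b -> pdiv n.+1 (a ^+ (p ^ n) - b ^+ (p ^ n)).
Proof.
move=> eab; elim: n => [|n IHn].
  rewrite !expr1; have /gr_ker[w ->] : red (a - b) = 0 by rewrite rmorphB eab subrr.
  by exists w.
rewrite expnSr !exprM subrXX -[n.+2]addn1; apply: pdivM => //.
have /gr_ker[w ->] : red (\sum_(i < p) (a ^+ (p ^ n)) ^+ (p.-1 - i) * (b ^+ (p ^ n)) ^+ i) = 0.
  rewrite rmorph_sum /= (eq_bigr (fun=> red b ^+ (p ^ n * p.-1))) => [|i _].
    by rewrite sumr_const card_ord -mulr_natr (pcharf0 pcharF) mulr0.
  rewrite rmorphM !rmorphXn eab -!exprM -exprD -mulnDr subnK // -ltnS prednK //.
  exact: prime_gt0.
by exists w.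
Qed.

Lemma expr_pX_eq n (a b : W) :
  (K <= n)%N -> red a = red b -> a ^+ (p ^ n) = b ^+ (p ^ n).
Proof.
move=> leKn /(expr_pX_congr n)/pdiv_pK; rewrite leqW // => /(_ isT)/eqP.
by rewrite subr_eq0 => /eqP.
Qed.

(** [u ^+ m] and the indicator have the same reduction, so their [p ^ n]-th powers agree; being 0 or
    1, the indicator is its own power. *)
Lemma expr_indicator m n (u : W) : (0 < m)%N -> (K <= n)%N ->
  red u = 0 \/ red u ^+ m = 1 -> u ^+ (m * p ^ n) = (red u != 0)%:R.
Proof.
move=> m_gt0 leKn red_u; have bE : (red u != 0)%:R ^+ (p ^ n) = (red u != 0)%:R :> W.
  by case: (_ != 0); rewrite /= ?expr1n ?expr0n ?expn_eq0 ?(gtn_eqF (prime_gt0 p_pr)).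
rewrite exprM -bE; apply: expr_pX_eq => //; rewrite rmorphXn rmorph_nat.
case: red_u => [-> | um]; first by rewrite eqxx expr0n gtn_eqF.
rewrite um; have -> // : red u != 0.
by apply/eqP => u0; move/eqP: um; rewrite u0 expr0n gtn_eqF // eq_sym oner_eq0.
Qed.

Lemma expf_N (x : F) : x != 0 -> x ^+ N = 1.
Proof.
by move=> x0; apply: (mulfI x0); rewrite mulr1 -exprS -pTE -cardF expf_card.
Qed.

Lemma N_gt0 : (0 < N)%N.
Proof. by rewrite -ltnS -pTE -cardF finNzRing_gt1. Qed.

Lemma gr_inv (u : W) : red u != 0 -> exists v, v * u = 1.
Proof.
move=> u0; exists (u ^+ (N * p ^ K).-1); rewrite -exprSr prednK; last first.
  by rewrite muln_gt0 N_gt0 expn_gt0 prime_gt0.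
rewrite expr_indicator ?N_gt0 ?u0 //; right; exact: expf_N.
Qed.

Lemma gr_mulfI (u a b : W) : red u != 0 -> u * a = u * b -> a = b.
Proof.
by case/gr_inv=> v vu /(congr1 (fun w => v * w)); rewrite !mulrA vu !mul1r.
Qed.

Lemma pdiv_unit k (u w : W) : red u != 0 -> pdiv k (u * w) -> pdiv k w.
Proof.
by case/gr_inv=> v vu /(pdivMl v); rewrite mulrA vu mul1r.
Qed.

(** The exponent is a power of [#|F|], so the result still reduces to [x], and it is a multiple of
    [p ^ K], so the result does not depend on the chosen lift. *)
Definition teich (x : F) : W := gr_lift W x ^+ (p ^ (T * K)).

Let leK : (K <= T * K)%N.
Proof. exact: leq_pmull. Qed.

Lemma teichK x : red (teich x) = x.
Proof.
rewrite rmorphXn gr_liftK expnM -cardF; elim: K => [|k IHk]; first by rewrite expr1.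
by rewrite expnSr exprM IHk expf_card.
Qed.

Lemma teichM : {morph teich : x y / x * y}.
Proof.
move=> x y; rewrite /teich -exprMn; apply: expr_pX_eq => //.
by rewrite rmorphM /= !gr_liftK.
Qed.

Lemma teich1 : teich 1 = 1.
Proof.
rewrite -[RHS](expr1n _ (p ^ (T * K))); apply: expr_pX_eq => //.
by rewrite rmorph1 gr_liftK.
Qed.

Lemma teich0 : teich 0 = 0.
Proof.
have <- : 0 ^+ (p ^ (T * K)) = 0 :> W.
  by rewrite expr0n expn_eq0 (gtn_eqF (prime_gt0 p_pr)).
by apply: expr_pX_eq => //; rewrite rmorph0 gr_liftK.
Qed.

Lemma teichX n : {morph teich : x / x ^+ n}.
Proof.
by move=> x; elim: n => [|n IHn]; rewrite ?teich1 // !exprS teichM IHn.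
Qed.

Lemma teichXN x m : (0 < m)%N -> (N %| m)%N -> teich x ^+ m = (x != 0)%:R.
Proof.
move=> m_gt0 /dvdnP[k mE]; rewrite -teichX.
have [-> | x0] := eqVneq x 0; first by rewrite expr0n gtn_eqF // teich0.
by rewrite mE mulnC exprM expf_N // expr1n teich1.
Qed.

Lemma teich_sum (J : finType) (x : J -> F) m n : (0 < m)%N -> (K <= n)%N ->
  (\sum_j x j) = 0 \/ (\sum_j x j) ^+ m = 1 ->
  (\sum_j teich (x j)) ^+ (m * p ^ n) = (\sum_j x j != 0)%:R.
Proof.
move=> m_gt0 leKn; have redE : red (\sum_j teich (x j)) = \sum_j x j.
  by rewrite rmorph_sum; apply: eq_bigr => j _; exact: teichK.
by rewrite -redE; exact: expr_indicator.
Qed.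

(** The substitution [h] shows that the sum is [c] times itself, and [c - 1] is a unit because its
    reduction is nonzero. *)
Lemma sum_twist (X : finType) (A : {pred X}) (h : X -> X) (f : X -> W) c :
  injective h -> (forall x, (h x \in A) = (x \in A)) ->
  (forall x, x \in A -> f (h x) = c * f x) -> red c != 1 ->
  \sum_(x in A) f x = 0.
Proof.
move=> h_inj hA fh c1; apply: (@gr_mulfI (c - 1)).
  by rewrite rmorphB rmorph1 subr_eq0.
rewrite mulr0 mulrBl mul1r; apply/eqP; rewrite subr_eq0; apply/eqP.
rewrite [RHS](reindex_inj h_inj) /= big_distrr /=.
by rewrite (eq_bigl _ _ hA); apply: eq_bigr => x /fh ->.
Qed.

Lemma generator_order : exists2 th : F, th != 0 & forall m, (th ^+ m == 1) = (N %| m)%N.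
Proof.
have /cyclicP[u uE] := field_unit_group_cyclic [set: {unit F}]%G.
exists (val u) => [|m]; first by rewrite -unitfE (valP u).
have -> : N = #[u]%g by rewrite /order -uE /= card_finField_unit cardF.
by rewrite order_dvdn -val_eqE /= FinRing.val_unitX.
Qed.

Lemma sum_teich m : ~~ (N %| m)%N -> \sum_x teich x ^+ m = 0.
Proof.
have [th th0 thE] := generator_order; rewrite -thE => thm.
apply: (@sum_twist _ predT ( *%R th) _ (teich th ^+ m)) => //.
- exact: mulfI.
- by move=> x _; rewrite teichM exprMn.
by rewrite rmorphXn teichK.
Qed.

Lemma sum_teich0 m : (N %| m)%N -> (0 < m)%N -> \sum_x teich x ^+ m = N%:R.
Proof.
move=> Nm m_gt0; under eq_bigr do rewrite teichXN //.
rewrite -natr_sum /N -cardF -(cardsC1 (0 : F)) -sum1_card [in RHS]big_mkcond /=.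
by congr _%:R; apply: eq_bigr => x _; rewrite !inE; case: (_ == _).
Qed.

End Teichmuller.

(** * Jacobi sums *)

Section JacobiSums.
Variables (p K : nat) (F : finFieldType) (W : galois_ring F p K).
Variable T : nat.
Hypotheses (p_pr : prime p) (T_gt0 : (0 < T)%N) (cardF : #|F| = (p ^ T)%N).

Local Notation N := (p ^ T).-1.
Local Notation teich := (teich W T).
Local Notation cyc := (cyc p T).

Definition dot (P L : 'I_3 -> F) : F := \sum_i P i * L i.

(** A homogeneous Jacobi sum: when [N] divides [\sum_i n i], it is [N] times the classical sum over
    the triples with sum 1. *)
Definition jac (n : 'I_3 -> nat) : W :=
  \sum_(L : {ffun 'I_3 -> F} | \sum_i L i != 0) \prod_i teich (L i) ^+ n i.

Lemma teich_inv_expr (a : F) m n : a != 0 -> (N %| n + m)%N ->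
  teich a^-1 ^+ n = teich a ^+ m.
Proof.
move=> a0 /dvdnP[k nm]; rewrite -!teichX //; congr teich.
apply: (mulfI (expf_neq0 n a0)); rewrite -exprMn mulfV // expr1n -exprD nm.
by rewrite mulnC exprM (expf_N p_pr cardF) // expr1n.
Qed.

(** If all [P i] are nonzero, replacing [L i] by [L i / P i] gives a Jacobi sum. If [P i = 0], then
    [dot P L] does not depend on [L i], and scaling [L i] shows that the left side vanishes; the
    right side does because [m i > 0]. *)
Lemma dot_sum (P : 'I_3 -> F) (n m : 'I_3 -> nat) :
  (forall i, ~~ (N %| n i)%N) -> (forall i, (N %| n i + m i)%N) ->
  (forall i, (0 < m i)%N) ->
  \sum_(L : {ffun 'I_3 -> F} | dot P L != 0) \prod_i teich (L i) ^+ n i =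
  jac n * \prod_i teich (P i) ^+ m i.
Proof.
move=> Nn Nnm m_gt0; have [/existsP[i /eqP Pi0] | /existsPn P0] := boolP [exists i, P i == 0].
  rewrite [\prod_(j < 3) teich (P j) ^+ _](bigD1 i) //= Pi0 teich0 // expr0n gtn_eqF //.
  rewrite mul0r mulr0.
  have [th th0 thE] := generator_order cardF.
  apply: (@sum_twist _ _ _ W _ p_pr cardF _ [pred L : {ffun 'I_3 -> F} | dot P L != 0]
    (fun L => [ffun k => if k == i then th * L k else L k]) _ (teich th ^+ n i)).
  - move=> L L' /ffunP eL; apply/ffunP => k; have := eL k; rewrite !ffunE.
    by case: eqP => // _ /(mulfI th0).
  - move=> L; rewrite !inE; congr (_ != _); apply: eq_bigr => k _.
    by rewrite ffunE; case: eqP => // ->; rewrite Pi0 !mul0r.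
  - move=> L _; rewrite (bigD1 i) //= [in RHS](bigD1 i) //= mulrA; congr (_ * _).
      by rewrite ffunE eqxx teichM // exprMn.
    by apply: eq_bigr => k ki; rewrite ffunE (negPf ki).
  by rewrite rmorphXn /= teichK // thE Nn.
pose h (L : {ffun 'I_3 -> F}) := [ffun i => L i / P i].
have h_inj : injective h.
  move=> L L' /ffunP eL; apply/ffunP => k; have := eL k; rewrite !ffunE.
  by apply: mulIf; rewrite invr_eq0 P0.
rewrite (reindex_inj h_inj) /= /jac big_distrl /=; apply: eq_big => [L | L _].
  by congr (_ != _); apply: eq_bigr => k _; rewrite ffunE mulrC divfK ?P0.
rewrite -big_split; apply: eq_bigr => k _ /=.
by rewrite ffunE teichM // exprMn (@teich_inv_expr _ (m k)) ?P0.
Qed.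

Lemma card_injF3 (phi : {ffun 'I_3 -> F} -> F * F * F) (A : {set F * F * F}) :
  injective phi -> #|[set P | phi P \in A]| = #|A|.
Proof.
move=> phi_inj; apply: on_card_preimset; apply: onW_bij.
apply: inj_card_bij => //.
by rewrite card_ffun card_ord !card_prod !expnSr mul1n.
Qed.

Lemma card_nonzero : #|[set~ (0 : F)]| = N.
Proof. by rewrite cardsC1 cardF. Qed.

Lemma card_sum_neq0 :
  #|[set P : {ffun 'I_3 -> F} | \sum_i P i != 0]| = (N * p ^ T * p ^ T)%N.
Proof.
pose phi (P : {ffun 'I_3 -> F}) := (\sum_i P i, P (inord 1), P (inord 2)).
rewrite -card_nonzero -cardF -!cardsT -!cardsX -(@card_injF3 phi).
  by apply: eq_card => P; rewrite !inE !andbT.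
move=> P P' []; rewrite !big_ord_recl !big_ord0 !addr0.
have -> : lift ord0 ord0 = inord 1 :> 'I_3 by apply/val_inj; rewrite /= inordK.
have -> : lift ord0 (lift ord0 ord0) = inord 2 :> 'I_3 by apply/val_inj; rewrite /= inordK.
move=> + e1 e2; rewrite e1 e2 => /addIr e0; apply/ffunP => k.
have : [|| k == ord0, k == inord 1 | k == inord 2].
  by rewrite -!val_eqE /= !inordK //; case: k => [[|[|[]]]].
by case/or3P => /eqP->.
Qed.

(** When [L i != L j], the linear forms [\sum_i P i], [dot P L] and [P k] are independent and serve
    as coordinates. *)
Lemma card_dot_neq0 (i j k : 'I_3) (L : 'I_3 -> F) :
  uniq [:: i; j; k] -> L i != L j ->
  #|[set P : {ffun 'I_3 -> F} | (\sum_i P i != 0) && (dot P L != 0)]| =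
  (N * N * p ^ T)%N.
Proof.
move=> ijk Lij; pose phi (P : {ffun 'I_3 -> F}) := (\sum_i P i, dot P L, P k).
have ijkT : perm_eq (index_enum 'I_3) [:: i; j; k].
  apply: uniq_perm; rewrite ?index_enum_uniq // => x; rewrite mem_index_enum.
  have /subset_cardP : #|[:: i; j; k]| = #|'I_3| by rewrite (card_uniqP ijk) card_ord.
  by move/(_ (subset_predT _))->.
have sum3 (f : 'I_3 -> F) : \sum_l f l = f i + f j + f k.
  by rewrite (perm_big _ ijkT) !big_cons big_nil /= addr0 addrA.
rewrite -card_nonzero -cardF -[#|F|]cardsT -!cardsX -(@card_injF3 phi).
  by apply: eq_card => P; rewrite !inE !andbT.
move=> P P' []; rewrite /dot !sum3 => + + ek; rewrite ek => /addIr e1 /addIr e2.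
have ei : P i = P' i.
  apply/eqP; rewrite -subr_eq0; apply/eqP; apply: (@mulIf _ (L i - L j)).
    by rewrite subr_eq0.
  have -> : (P i - P' i) * (L i - L j) =
      (P i * L i + P j * L j - (P' i * L i + P' j * L j)) - (P i + P j - (P' i + P' j)) * L j.
    by ring.
  by rewrite e1 e2 !subrr !mul0r subr0.
apply/ffunP => x; have: x \in [:: i; j; k] by rewrite -(perm_mem ijkT) mem_index_enum.
rewrite !inE => /or3P[] /eqP-> //.
by move: e1; rewrite ei => /addrI.
Qed.

(** By [dot_sum] the product is the sum over [L] of [tn L] times the number [cnt L] of [P] with
    [\sum_i P i] and [dot P L] nonzero. This number is the same for all nonconstant [L], and the
    [tn L] add up to 0, so only constant [L] contribute, through the excess of [cnt L] over that
    value. *)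
Lemma jac_jac (n m : 'I_3 -> nat) :
  (forall i, ~~ (N %| n i)%N) -> (forall i, (N %| n i + m i)%N) ->
  (forall i, (0 < m i)%N) -> (N %| \sum_i n i)%N ->
  jac n * jac m = (p ^ T * N * N)%:R.
Proof.
move=> Nn Nnm m_gt0 Nsn.
have n_gt0 i : (0 < n i)%N by case: (n i) (Nn i); rewrite ?dvdn0.
have N1 : (p ^ T)%N = N.+1 by rewrite prednK ?expn_gt0 ?prime_gt0.
pose cnt (L : {ffun 'I_3 -> F}) :=
  #|[set P : {ffun 'I_3 -> F} | (\sum_i P i != 0) && (dot P L != 0)]|.
pose tn (L : {ffun 'I_3 -> F}) := \prod_i teich (L i) ^+ n i.
have -> : jac n * jac m = \sum_L tn L * (cnt L)%:R.
  rewrite [jac m]/jac big_distrr /=.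
  under eq_bigr do rewrite -(dot_sum _ Nn Nnm m_gt0).
  rewrite (exchange_big_dep predT) //=; apply: eq_bigr => L _.
  rewrite sumr_const mulr_natr; congr (_ *+ _).
  by apply: eq_card => P; rewrite !inE.
have tn0 : \sum_L tn L = 0.
  rewrite /tn -(bigA_distr_bigA (fun i x => teich x ^+ n i)) /= big_ord_recl.
  by rewrite sum_teich // mul0r.
pose cst (L : {ffun 'I_3 -> F}) := L == [ffun=> L ord0].
have cnt_noncst L : ~~ cst L -> cnt L = (N * N * p ^ T)%N.
  move=> Lc; have [L01 | L01] := eqVneq (L (inord 0)) (L (inord 1)); last first.
    apply: (@card_dot_neq0 (inord 0) (inord 1) (inord 2)) => //.
    by rewrite /= !inE -!val_eqE /= !inordK.
  apply: (@card_dot_neq0 (inord 1) (inord 2) (inord 0)).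
    by rewrite /= !inE -!val_eqE /= !inordK.
  apply: contra Lc => /eqP L12; apply/eqP/ffunP => k; rewrite ffunE.
  have e0 : ord0 = inord 0 :> 'I_3 by apply/val_inj; rewrite /= inordK.
  rewrite e0; have : [|| k == inord 0, k == inord 1 | k == inord 2].
    by rewrite -!val_eqE /= !inordK //; case: (k) => [[|[|[]]]].
  by case/or3P => /eqP->; rewrite -?L12.
have cnt_cst a : a != 0 -> cnt [ffun=> a] = (N * p ^ T * p ^ T)%N.
  move=> a0; rewrite -card_sum_neq0; apply: eq_card => P; rewrite !inE.
  have -> : dot P [ffun=> a] = (\sum_i P i) * a.
    by rewrite mulr_suml; apply: eq_bigr => i _; rewrite ffunE.
  by rewrite mulf_eq0 (negPf a0) orbF andbb.
have -> : \sum_L tn L * (cnt L)%:R =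
    \sum_(L | cst L) tn L * ((cnt L)%:R - (N * N * p ^ T)%:R).
  have E : \sum_L tn L * (N * N * p ^ T)%:R = 0 by rewrite -mulr_suml tn0 mul0r.
  apply: etrans (esym (subr0 _)) _; rewrite -[X in _ - X]E -sumrB.
  rewrite [RHS]big_mkcond; apply: eq_bigr => L _; rewrite -mulrBr.
  by case: ifP => // /negbT/cnt_noncst ->; rewrite subrr mulr0.
rewrite (reindex_onto (fun a : F => [ffun=> a]) (fun L : {ffun 'I_3 -> F} => L ord0)) /=;
  last by move=> L /eqP/esym.
have -> : (p ^ T * N * N)%:R = N%:R * ((N * p ^ T * p ^ T)%:R - (N * N * p ^ T)%:R) :> W.
  rewrite -natrB; last by rewrite leq_mul2r leq_mul2l leq_pred !orbT.
  rewrite -natrM -mulnBl -mulnBr (_ : p ^ T - N = 1)%N; last by move: N1; lia.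
  by congr _%:R; ring.
rewrite -(sum_teich0 W p_pr T_gt0 cardF Nsn) ?mulr_suml; last first.
  by rewrite big_ord_recl addn_gt0 n_gt0.
apply: eq_big => [a | a _]; first by rewrite /cst ffunE !eqxx.
have -> : tn [ffun=> a] = teich a ^+ (\sum_i n i).
  by rewrite expr_sum; apply: eq_bigr => i _; rewrite ffunE.
have [-> | a0] := eqVneq a 0; last by rewrite cnt_cst.
by rewrite teich0 // expr0n gtn_eqF ?mul0r // big_ord_recl addn_gt0 n_gt0.
Qed.

(** The indicator of [\sum_i L i != 0] is a power of a sum of Teichmueller lifts. In its expansion
    only exponents [e i] opposite to [m i] modulo [N] survive; their digit sums are complementary to
    those of [m], which makes the multinomial coefficients divisible by [p ^ lam]. *)
Lemma jac_pdiv (m : 'I_3 -> nat) lam :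
  (forall i, ~~ (N %| m i)%N) ->
  (\sum_i cyc (m i) + lam * N <= 2 * (T * N))%N ->
  pdiv lam (jac m).
Proof.
move=> Nm le_m.
have N_gt0 : (0 < N)%N by exact: (N_gt0 p_pr cardF).
have -> : jac m = \sum_(L : {ffun 'I_3 -> F}) (\prod_i teich (L i) ^+ m i) *
                     (\sum_i teich (L i)) ^+ (N * p ^ K).
  rewrite /jac big_mkcond; apply: eq_bigr => L _.
  rewrite teich_sum //; first by case: ifP => _; rewrite ?mulr1 ?mulr0.
  have [-> | s0] := eqVneq (\sum_i L i) 0; [by left | right].
  exact: (expf_N p_pr cardF).
apply: sum_expr_ind; [exact: pdiv0 | exact: pdivD |] => e c sum_e cE.
under eq_bigr do rewrite -big_split /=.
under eq_bigr do under eq_bigr do rewrite -exprD.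
rewrite -(bigA_distr_bigA (fun i x => teich x ^+ (m i + e i))) /=.
have [/forallP Nme | /forallPn[i Nme]] := boolP [forall i, N %| m i + e i]%N; last first.
  by rewrite (bigD1 i) //= sum_teich // mul0r mulr0; apply: pdiv0.
apply/pdivMr/pdiv_nat.
have c_gt0 : (0 < c)%N by have := fact_gt0 (N * p ^ K); rewrite -cE muln_gt0 => /andP[].
rewrite pfactor_dvdn // -(leq_pmul2r N_gt0).
have := logn_multinomial p_pr T_gt0 sum_e cE.
have : (\sum_i cyc (m i) + \sum_i cyc (e i) = 3 * (T * N))%N.
  rewrite -big_split /= (eq_bigr (fun=> T * N)%N) ?sum_nat_const ?card_ord // => i _.
  apply: cyc_opp => //; rewrite lt0n; apply: contra (Nm i) => /eqP e0.
  by have := Nme i; rewrite e0 addn0.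
by move: le_m; lia.
Qed.

End JacobiSums.

(** * Monomial sums over a unital *)

Lemma point_of_row (F : finFieldType) (v : 'rV[F]_3) : v != 0 ->
  exists (P : point F) (c : F), c != 0 /\ v = c *: val P.
Proof.
move=> v0; suff [c c0 nv] : exists2 c : F, c != 0 & normalized (c^-1 *: v).
  by exists (Sub (c^-1 *: v) nv), c; split=> //=; rewrite scalerA mulfV // scale1r.
have [v00 | v00] := eqVneq (v 0 i0) 0; last first.
  by exists (v 0 i0); rewrite // /normalized !mxE mulVf ?eqxx.
have [v01 | v01] := eqVneq (v 0 i1) 0; last first.
  by exists (v 0 i1); rewrite // /normalized !mxE v00 mulr0 mulVf ?eqxx ?orbT.
have [v02 | v02] := eqVneq (v 0 i2) 0; last first.
  by exists (v 0 i2); rewrite // /normalized !mxE v00 v01 !mulr0 mulVf ?eqxx ?orbT.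
case/eqP: v0; apply/rowP => i; rewrite mxE.
have : [|| i == i0, i == i1 | i == i2] by case: i => [[|[|[]]]].
by case/or3P => /eqP->.
Qed.

Section Unital.
Variables (p t K : nat) (F : finFieldType) (W : galois_ring F p K).
Hypotheses (p_pr : prime p) (t_gt0 : (0 < t)%N) (cardF : #|F| = (p ^ (2 * t))%N).

Local Notation T := (2 * t)%N.
Local Notation q := (p ^ t)%N.
Local Notation N := (p ^ T).-1.
Local Notation teich := (teich W T).
Local Notation cyc := (cyc p T).

Let T_gt0 : (0 < T)%N.
Proof. by rewrite muln_gt0. Qed.

Let pTE : (p ^ T = N.+1)%N.
Proof. by rewrite prednK ?expn_gt0 ?prime_gt0. Qed.

Variable U : {set point F}.
Hypothesis U_unital : is_unital q U.

Definition coord (P : point F) (i : 'I_3) : F := val P 0 i.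

(** A line misses [q ^ 3] or [q ^ 3 - q] points of [U]; for [L = 0] no point is counted. *)
Lemma unital_dot_neq0 (L : 'I_3 -> F) :
  (q %| #|[set P in U | dot (coord P) L != 0%R]|)%N.
Proof.
have [L0 | Ln0] := eqVneq (\row_i L i) 0.
  rewrite (_ : [set P in U | _] = set0) ?cards0 ?dvdn0 //.
  apply/setP=> P; rewrite !inE /dot big1 ?eqxx ?andbF // => i _.
  by move/rowP/(_ i): L0; rewrite !mxE => ->; rewrite mulr0.
have [L' [c [c0 LE]]] := point_of_row Ln0.
have -> : [set P in U | dot (coord P) L != 0] = U :\: [set P in U | incident P L'].
  apply/setP=> P; rewrite !inE negb_and andb_orl andNb /= andbC.
  congr (~~ _ && _); rewrite /incident /dot.
  rewrite (eq_bigr (fun i => c * (val P 0 i * val L' 0 i))) => [|i _].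
    by rewrite -big_distrr mulf_eq0 (negPf c0).
  by move/rowP/(_ i): LE; rewrite !mxE => ->; rewrite mulrCA.
have [cardU /(_ L') cardL] := U_unital.
rewrite cardsD (setIidPr _) ?cardU; last by apply/subsetP=> P; rewrite inE => /andP[].
case: cardL => ->; first by rewrite addnK dvdn_exp.
by rewrite -[q.+1]addn1 subnDr dvdn_sub // dvdn_exp.
Qed.

Definition unital_sum (m : 'I_3 -> nat) : W :=
  \sum_(P in U) \prod_i teich (coord P i) ^+ m i.

Lemma sum_dot_pdiv (X : finType) (f : X -> W) (L : X -> 'I_3 -> F) :
  pdiv t (\sum_(P in U) \sum_(x | dot (coord P) (L x) != 0) f x).
Proof.
rewrite (exchange_big_dep predT) //=; apply: pdiv_sum => x _.
rewrite sumr_const -mulr_natr; apply: pdivMl; apply: pdiv_nat.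
rewrite (_ : #|_| = #|[set P in U | dot (coord P) (L x) != 0]|) ?unital_dot_neq0 //.
by apply: eq_card => P; rewrite !inE.
Qed.

Let red_N : gr_red W N%:R = -1.
Proof.
rewrite rmorph_nat; apply/eqP; rewrite -subr_eq0 opprK natr1 -pTE.
by rewrite natrX (pcharf0 (pcharF p_pr cardF)) expr0n gtn_eqF.
Qed.

(** With [n] the inverse exponents, [q] divides [jac n * S] and [p ^ (t + k)] divides [jac m], so
    [p ^ (2 t + k)] divides [q ^ 2 * N ^ 2 * S]. Here [N] is a unit, and [3 t <= K] leaves room for
    cancelling [q ^ 2]. *)
Lemma unital_sum_generic (m : 'I_3 -> nat) k : (k <= t)%N -> (3 * t <= K)%N ->
  (forall i, ~~ (N %| m i)%N) -> (N %| \sum_i m i)%N ->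
  (\sum_i cyc (m i) + k * N <= 3 * t * N)%N -> pdiv k (unital_sum m).
Proof.
move=> lekt leK Nm Nsm le_m.
pose n i := (N.-1 * m i)%N.
have N_gt0 := N_gt0 p_pr cardF.
have nmE i : (n i + m i = N * m i)%N by rewrite addnC -mulSn prednK.
have Nnm i : (N %| n i + m i)%N by rewrite nmE dvdn_mulr.
have Nn i : ~~ (N %| n i)%N by apply: contra (Nm i) => Nni; rewrite -(dvdn_addr _ Nni).
have m_gt0 i : (0 < m i)%N by case: (m i) (Nm i); rewrite ?dvdn0.
have Nsn : (N %| \sum_i n i)%N by rewrite -big_distrr dvdn_mull.
have step1 : pdiv t (jac W T n * unital_sum m).
  rewrite big_distrr /=; under eq_bigr do rewrite -(dot_sum W p_pr T_gt0 cardF _ Nn Nnm m_gt0).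
  exact: sum_dot_pdiv.
have step2 : pdiv (t + k) (jac W T m).
  have H := (@jac_pdiv _ _ _ W _ p_pr T_gt0 cardF m (t + k) Nm); apply: H; move: le_m; lia.
have := pdivM step2 step1.
rewrite mulrA [jac _ _ _ * _]mulrC (jac_jac W p_pr T_gt0 cardF Nn Nnm m_gt0 Nsn).
rewrite (_ : t + k + t = T + k)%N; last by lia.
rewrite -mulnA natrM natrX -mulrA => /pdiv_cancel.
move=> /(_ (leq_trans (_ : (T + k <= 3 * t)%N) leK)) H.
apply: (pdiv_unit p_pr cardF) (H _); last by lia.
by rewrite natrM rmorphM red_N mulrNN mulr1 oner_eq0.
Qed.

(** Here the sum counts the points of [U] off the coordinate line [x_i = 0]; [unit] indexes this
    one-element family of lines. *)
Lemma unital_sum_line i (m : 'I_3 -> nat) : (0 < m i)%N -> (N %| m i)%N ->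
  (forall j, j != i -> m j = 0%N) -> pdiv t (unital_sum m).
Proof.
move=> mi_gt0 Nmi m0.
have -> : unital_sum m = \sum_(P in U) \sum_(x : unit | dot (coord P) (fun j => (j == i)%:R) != 0) 1.
  apply: eq_bigr => P _; rewrite (bigD1 i) //= big1 ?mulr1 => [|j /m0 ->]; last exact: expr0.
  rewrite (teichXN W p_pr T_gt0 cardF) //.
  have -> : dot (coord P) (fun j => (j == i)%:R) = coord P i.
    rewrite /dot (bigD1 i) //= eqxx mulr1 big1 ?addr0 // => j /negPf->.
    by rewrite mulr0.
  by case: (_ == _); [rewrite big_pred0 | rewrite (big_pred1 tt) // => -[]].
exact: (@sum_dot_pdiv unit (fun=> 1) (fun=> _)).
Qed.

(** Two-variable analogue of [dot_sum], for lines through a coordinate vertex. For fixed [a] and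
    nonzero [y] the sum over [b] omits one value, so orthogonality leaves minus the omitted term. In
    place of a Jacobi sum there is a unit. *)
Lemma sum_pencil (x y : F) m n : ~~ (N %| m)%N -> ~~ (N %| n)%N -> (N %| m + n)%N ->
  \sum_(ab : F * F | x * ab.1 + y * ab.2 != 0) teich ab.1 ^+ n * teich ab.2 ^+ m =
  - (N%:R * teich (-1) ^+ m) * (teich x ^+ m * teich y ^+ n).
Proof.
move=> Nm Nn Nmn.
have m_gt0 : (0 < m)%N by case: (m) Nm; rewrite ?dvdn0.
have n_gt0 : (0 < n)%N by case: (n) Nn; rewrite ?dvdn0.
rewrite -(pair_big_dep predT (fun a b => x * a + y * b != 0)
  (fun a b => teich a ^+ n * teich b ^+ m)) /=.
have [-> | y0] := eqVneq y 0.
  rewrite teich0 // expr0n gtn_eqF // !mulr0 big1 // => a _.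
  under eq_bigl do rewrite mul0r addr0.
  by case: (_ != 0); [rewrite -big_distrr /= sum_teich // mulr0 | rewrite big_pred0].
have inner a : \sum_(b | x * a + y * b != 0) teich a ^+ n * teich b ^+ m =
    - (teich (-1) ^+ m * teich x ^+ m * teich y ^+ n * teich a ^+ (m + n)).
  rewrite -big_distrr /=.
  have bE b : (x * a + y * b != 0) = (b != - (x * a) / y).
    by rewrite addr_eq0 -eqr_opp opprK eq_sym -[in RHS](inj_eq (mulfI y0)) mulrCA mulfV ?mulr1.
  under eq_bigl do rewrite bE.
  have := sum_teich W p_pr T_gt0 cardF Nm; rewrite (bigD1 (- (x * a) / y)) //=.
  move/eqP; rewrite addrC addr_eq0 => /eqP->; rewrite mulrN; congr (- _).
  rewrite !teichM // -[- (x * a)]mulN1r !teichM // !exprMn.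
  by rewrite (@teich_inv_expr _ _ _ W _ p_pr T_gt0 cardF _ n) //; rewrite exprD; ring.
under eq_bigr do rewrite inner.
rewrite sumrN -big_distrr /= sum_teich0 // ?addn_gt0 ?m_gt0 //.
by ring.
Qed.

Lemma unital_sum_pencil i j (m : 'I_3 -> nat) : i != j -> ~~ (N %| m i)%N -> ~~ (N %| m j)%N ->
  (N %| m i + m j)%N -> (forall l, l != i -> l != j -> m l = 0%N) ->
  pdiv t (unital_sum m).
Proof.
move=> ij Nmi Nmj Nmij m0.
apply: (@pdiv_unit _ _ _ _ _ p_pr cardF _ (- (N%:R * teich (-1) ^+ m i))).
  rewrite rmorphN rmorphM red_N rmorphXn teichK // oppr_eq0 mulf_neq0 //.
    by rewrite oppr_eq0 oner_eq0.
  by rewrite expf_neq0 // oppr_eq0 oner_eq0.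
pose L (ab : F * F) (l : 'I_3) := if l == i then ab.1 else if l == j then ab.2 else 0.
have ji : j != i by rewrite eq_sym.
have dotE P ab : dot (coord P) (L ab) = coord P i * ab.1 + coord P j * ab.2.
  rewrite /dot (bigD1 i) // (bigD1 j) //= /L eqxx (negPf ji) eqxx.
  rewrite big1 ?addr0 // => l /andP[/negPf-> /negPf->]; exact: mulr0.
rewrite big_distrr /= (eq_bigr (fun P => \sum_(ab : F * F | dot (coord P) (L ab) != 0)
    teich ab.1 ^+ m j * teich ab.2 ^+ m i)); first exact: sum_dot_pdiv.
move=> P _; rewrite [RHS](eq_bigl (fun ab => coord P i * ab.1 + coord P j * ab.2 != 0));
  last by move=> ab; rewrite dotE.
rewrite sum_pencil //; congr (_ * _).
rewrite (bigD1 i) // (bigD1 j) //= big1 ?mulr1 // => l /andP[li lj].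
by rewrite m0 // expr0.
Qed.

End Unital.

(** * Unitals and Hermitian forms *)

Lemma big_pairE (R : Type) (idx : R) (op : Monoid.com_law idx) (I J : finType)
    (f : I * J -> R) :
  \big[op/idx]_ij f ij = \big[op/idx]_i \big[op/idx]_j f (i, j).
Proof. by rewrite pair_bigA; apply: eq_bigr => -[]. Qed.

Section HermitianForm.
Variables (p t : nat) (F : finFieldType).
Hypotheses (p_pr : prime p) (t_gt0 : (0 < t)%N) (cardF : #|F| = (p ^ (2 * t))%N).
Local Notation q := (p ^ t)%N.

Lemma exprDq (x y : F) : (x + y) ^+ q = x ^+ q + y ^+ q.
Proof.
apply: exprDn_pchar; rewrite (eq_pnat _ (pcharf_eq (pcharF p_pr cardF))).
by rewrite pnatX pnat_id.
Qed.

Lemma expr_sumq I (r : seq I) (P : pred I) (f : I -> F) :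
  (\sum_(i <- r | P i) f i) ^+ q = \sum_(i <- r | P i) f i ^+ q.
Proof.
apply: (big_morph (fun x => x ^+ q) exprDq).
by rewrite expr0n expn_eq0 (gtn_eqF (prime_gt0 p_pr)).
Qed.

Lemma expr_qq (x : F) : (x ^+ q) ^+ q = x.
Proof. by rewrite -exprM -expnD addnn -mul2n -cardF expf_card. Qed.

Lemma herm_valueE (A : 'M[F]_3) (v : 'rV[F]_3) :
  herm_value q A v = \sum_(ij : 'I_3 * 'I_3) A ij.1 ij.2 * v 0 ij.1 * v 0 ij.2 ^+ q.
Proof.
rewrite -(pair_bigA _ (fun i j => A i j * v 0 i * v 0 j ^+ q)) /= exchange_big.
rewrite /herm_value mxE; apply: eq_bigr => j _; rewrite !mxE big_distrl.
by apply: eq_bigr => i _ /=; rewrite /conjq; ring.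
Qed.

(** The [q]-th power exchanges the terms of [(i, j)] and [(j, i)], so the value lies in GF(q). *)
Lemma herm_value_conj (A : 'M[F]_3) (v : 'rV[F]_3) : Defs.hermitian_matrix q A ->
  herm_value q A v ^+ q = herm_value q A v.
Proof.
case/andP=> /eqP/matrixP AT _; rewrite herm_valueE expr_sumq.
have swap_inj : injective (fun ij : 'I_3 * 'I_3 => (ij.2, ij.1)).
  by move=> [i j] [i' j'] [-> ->].
rewrite [RHS](reindex_inj swap_inj) /=; apply: eq_bigr => -[i j] _ /=.
by have := AT i j; rewrite !mxE /conjq !exprMn expr_qq => ->; ring.
Qed.

Lemma herm_value_expr (A : 'M[F]_3) (v : 'rV[F]_3) : Defs.hermitian_matrix q A ->
  herm_value q A v = 0 \/ herm_value q A v ^+ q.-1 = 1.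
Proof.
move=> hA; have [-> | h0] := eqVneq (herm_value q A v) 0; [by left | right].
apply: (mulfI h0); rewrite mulr1 -exprS prednK ?herm_value_conj //.
by rewrite expn_gt0 prime_gt0.
Qed.

End HermitianForm.

(** * The congruence for an arbitrary unital *)

Section HermitianUnital.
Variables (p t K : nat) (F : finFieldType) (W : galois_ring F p K).
Hypotheses (p_pr : prime p) (t_gt0 : (0 < t)%N) (cardF : #|F| = (p ^ (2 * t))%N).
Hypothesis leK : (3 * t <= K)%N.

Local Notation T := (2 * t)%N.
Local Notation q := (p ^ t)%N.
Local Notation N := (p ^ T).-1.
Local Notation teich := (teich W T).
Local Notation cyc := (cyc p T).

Let T_gt0 : (0 < T)%N.
Proof. by rewrite muln_gt0. Qed.

Variable U : {set point F}.
Hypothesis U_unital : is_unital q U.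

(** For [k > 0] there are three cases. If no [m i] is divisible by [N], the generic bound applies.
    If a positive one is, the others vanish and a single line suffices. Otherwise exactly one [m i]
    is 0 and the other two are opposite modulo [N]: the pencil case. *)
Lemma unital_sum_pdiv (m : 'I_3 -> nat) k : (k <= t)%N ->
  (N %| \sum_i m i)%N -> (0 < \sum_i m i)%N ->
  (\sum_i cyc (m i) + k * N <= 3 * t * N)%N -> pdiv k (unital_sum t W U m).
Proof.
move=> lekt Nsm sm_gt0 le_m.
have N_gt0 : (0 < N)%N := N_gt0 p_pr cardF.
have [-> | k_gt0] := posnP k; first exact: pdiv_any.
have [/forallP Nm | /forallPn[i /negPn Nmi]] := boolP [forall i, ~~ (N %| m i)%N].
  exact: (unital_sum_generic W p_pr t_gt0 cardF U_unital).
have [j /andP[mj_gt0 Nmj] | no_mj] :=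
    pickP [pred j | (0 < m j)%N && (N %| m j)%N].
  apply: (pdiv_leq lekt); apply: (unital_sum_line W p_pr t_gt0 cardF U_unital mj_gt0 Nmj).
  pose r := (\sum_l (l != j) * m l)%N.
  have rE : (\sum_l m l = m j + r)%N.
    rewrite /r (bigD1 j) //= [in RHS](bigD1 j) //= eqxx mul0n add0n.
    by congr (_ + _)%N; apply: eq_bigr => l ->; rewrite mul1n.
  have Nr : (N %| r)%N by rewrite -(dvdn_addr _ Nmj) -rE.
  (* If [r] were positive, [m j] and the remaining exponents would each contribute at least
     [T * N = 2 t N] to the digit sums, beyond the bound [3 t N]. *)
  have r0 : r = 0%N.
    apply/eqP; rewrite -leqn0 leqNgt; apply/negP => r_gt0.
    have := cyc_le p_pr T_gt0 (erefl (r %% N)%N) (fun _ => r_gt0).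
    rewrite (cyc_dvd p_pr T_gt0 r_gt0 Nr).
    have : (\sum_l cyc (m l) = cyc (m j) + \sum_l (l != j) * cyc (m l))%N.
      rewrite (bigD1 j) //= [in RHS](bigD1 j) //= eqxx mul0n add0n.
      by congr (_ + _)%N; apply: eq_bigr => l ->; rewrite mul1n.
    rewrite (cyc_dvd p_pr T_gt0 mj_gt0 Nmj); move: le_m.
    by move: (\sum_l _)%N (\sum_l _)%N => x y; nia.
  move=> l lj; move/eqP: r0; rewrite sum_nat_eq0 => /forallP/(_ l).
  by rewrite lj mul1n => /eqP.
have m0 l : (N %| m l)%N -> m l = 0%N.
  by move=> Nml; have := no_mj l; rewrite /= Nml andbT; case: (m l).
have [j mj_gt0] : exists j, (0 < m j)%N.
  apply/existsP; move: sm_gt0; apply: contraTT; rewrite negb_exists -leqNgt => /forallP m00.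
  by rewrite leqn0 sum_nat_eq0; apply/forallP => l; rewrite -leqn0 leqNgt; apply: m00.
have Nmj : ~~ (N %| m j)%N by apply: contraL mj_gt0 => /m0->.
have [l lj Nml] : exists2 l, l != j & ~~ (N %| m l)%N.
  have [l /andP[lj Nml] | no_l] := pickP [pred l | (l != j) && ~~ (N %| m l)%N].
    by exists l.
  have Nrest : (N %| \sum_(l | l != j) m l)%N.
    by apply: dvdn_sum => l lj; have := no_l l; rewrite /= lj => /negbFE.
  by move: Nsm; rewrite (bigD1 j) //= dvdn_addl // (negPf Nmj).
have ij : i != j by apply: contraL Nmi => /eqP->.
have il : i != l by apply: contraL Nmi => /eqP->.
have others x : x != j -> x != l -> m x = 0%N.
  move=> xj xl; suff -> : x = i by exact: m0.
  apply/eqP; apply: contraT => xi.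
  have /card_uniqP cU : uniq [:: i; j; l; x].
    by rewrite /= !inE !negb_or ij il !(eq_sym _ x) xi xj xl (eq_sym j) lj.
  by have := max_card [in [:: i; j; l; x]]; rewrite cU card_ord.
apply: (pdiv_leq lekt).
apply: (unital_sum_pencil W p_pr t_gt0 cardF U_unital (i := j) (j := l)) => //.
  by rewrite eq_sym.
rewrite (_ : m j + m l = \sum_i m i)%N // (bigD1 j) // (bigD1 l) //=.
by rewrite big1 ?addn0 // => x /andP[]; exact: others.
Qed.

Lemma unital_herm_neq0 (A : 'M[F]_3) : Defs.hermitian_matrix q A ->
  (p ^ uphalf t %| #|[set P in U | herm_value q A (val P) != 0%R]|)%N.
Proof.
move=> hA; have N_gt0 : (0 < N)%N := N_gt0 p_pr cardF.
have q1 : (0 < q.-1)%N.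
  by rewrite -ltnS prednK ?expn_gt0 ?prime_gt0 // -(expn0 p) ltn_exp2l ?prime_gt1.
have NE : N = (q.-1 * q.+1)%N.
  rewrite (_ : p ^ T = q * q)%N; last by rewrite -expnD addnn mul2n.
  by case: (q) q1 => //= k; nia.
have le_uphalf : (uphalf t <= K)%N by apply: leq_trans leK; lia.
apply: (@pdiv_natE _ _ _ W p_pr _ _ le_uphalf).
have -> : #|[set P in U | herm_value q A (val P) != 0]|%:R =
    \sum_(P : point F) (P \in U)%:R *
      (\sum_(ij : 'I_3 * 'I_3) teich (A ij.1 ij.2 * coord P ij.1 * coord P ij.2 ^+ q))
         ^+ (q.-1 * p ^ K) :> W.
  rewrite -sum1_card natr_sum big_mkcond; apply: eq_bigr => P _.
  rewrite (teich_sum W p_pr cardF q1 (leqnn K)); rewrite -herm_valueE ?inE.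
    by case: (P \in U); rewrite ?mul0r // mul1r; case: (_ != 0).
  exact: herm_value_expr.
apply: sum_expr_ind; [exact: pdiv0 | exact: pdivD |] => e c sum_e cE.
(* Exponent of the [i]-th coordinate: [e (i, j)] from the linear factor and [q * e (j, i)] from the
   conjugated one. *)
pose m i := (\sum_j (e (i, j) + q * e (j, i)))%N.
have prodE P : \prod_ij teich (A ij.1 ij.2 * coord P ij.1 * coord P ij.2 ^+ q) ^+ e ij =
   (\prod_ij teich (A ij.1 ij.2) ^+ e ij) * \prod_i teich (coord P i) ^+ m i.
  transitivity (\prod_(ij : 'I_3 * 'I_3) (teich (A ij.1 ij.2) ^+ e ij *
     (teich (coord P ij.1) ^+ e ij * teich (coord P ij.2) ^+ (q * e ij)))).
    by apply: eq_bigr => ij _; rewrite !teichM // teichX // !exprMn -!exprM mulrA.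
  rewrite !big_split /=; congr (_ * _).
  rewrite big_pairE [X in _ * X]big_pairE [X in _ * X]exchange_big -big_split; apply: eq_bigr => i _ /=.
  by rewrite /m expr_sum -big_split; apply: eq_bigr => j _ /=; rewrite exprD.
have -> : \sum_P (P \in U)%:R *
    \prod_ij teich (A ij.1 ij.2 * coord P ij.1 * coord P ij.2 ^+ q) ^+ e ij =
    (\prod_ij teich (A ij.1 ij.2) ^+ e ij) * unital_sum t W U m.
  rewrite big_distrr [RHS]big_mkcond; apply: eq_bigr => P _.
  by rewrite prodE; case: (P \in U); rewrite ?mul1r ?mul0r.
rewrite mulrCA; apply: pdivMl.
have sum_m : (\sum_i m i = q.+1 * (q.-1 * p ^ K))%N.
  rewrite -sum_e mulSn big_pairE /m.
  under eq_bigr do rewrite big_split /=.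
  rewrite big_split /=; congr (_ + _)%N.
  by rewrite exchange_big big_distrr; apply: eq_bigr => i _; rewrite big_distrr.
have c_gt0 : (0 < c)%N.
  by have := fact_gt0 (q.-1 * p ^ K); rewrite -cE muln_gt0 => /andP[].
have le_e := logn_multinomial p_pr T_gt0 sum_e cE.
(* Each [e ij] occurs twice among the [m i], once with a factor [q] that leaves its digit sum
   unchanged. *)
have le_m : (\sum_i cyc (m i) <= 2 * \sum_ij cyc (e ij))%N.
  have le_mi i : (cyc (m i) <= \sum_j (cyc (e (i, j)) + cyc (e (j, i))))%N.
    pose e' (x : 'I_3 + 'I_3) := match x with inl j => e (i, j) | inr j => (q * e (j, i))%N end.
    have mE : m i = (\sum_x 1 * e' x)%N.
      by rewrite big_sumType /= /m big_split; congr (_ + _)%N; apply: eq_bigr => j _; rewrite mul1n.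
    apply: leq_trans (cyc_le p_pr T_gt0 (w := fun=> 1%N) (congr1 (modn^~ N) mE) _) _.
      by rewrite -mE.
    rewrite big_sumType [leqRHS]big_split /=.
    by apply: leq_add; apply: leq_sum => j _; rewrite mul1n ?cycXp.
  apply: (@leq_trans (\sum_i \sum_j (cyc (e (i, j)) + cyc (e (j, i))))%N).
    by apply: leq_sum => i _; exact: le_mi.
  under eq_bigr do rewrite big_split /=.
  rewrite big_split /= [X in (_ + X)%N]exchange_big /= -(big_pairE _ (fun ij => cyc (e ij))) addnn -mul2n.
  exact: leqnn.
have pc v : (v <= logn p c)%N -> pdiv v (c%:R : W).
  by move=> le_v; apply: pdiv_nat; rewrite pfactor_dvdn.
(* Put [v = logn p c]. If [t <= 2 v] the coefficient suffices. Otherwise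
   [\sum_i cyc (m i) <= 2 (v + t) N] makes the monomial sum divisible by [p ^ (t - 2 v)], and
   [v + (t - 2 v) = t - v] is at least [uphalf t]. *)
have [le_t | lt_t] := leqP t (2 * logn p c).
  by apply: pdivMr; apply: pc; lia.
apply: (@pdiv_leq _ _ _ _ (logn p c + (t - 2 * logn p c))); first by lia.
apply: pdivM; first exact: pc.
apply: unital_sum_pdiv; first by lia.
- by rewrite sum_m NE mulnA [(q.-1 * q.+1)%N]mulnC dvdn_mulr.
- by rewrite sum_m !muln_gt0 q1 expn_gt0 (prime_gt0 p_pr).
by move: le_m le_e lt_t; nia.
Qed.

End HermitianUnital.

(** * Weighted Ax-Katz congruence *)

Section WeightedAx.
Variables (p t K : nat) (F : finFieldType) (W : galois_ring F p K).
Hypotheses (p_pr : prime p) (t_gt0 : (0 < t)%N) (cardF : #|F| = (p ^ (2 * t))%N).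

Local Notation T := (2 * t)%N.
Local Notation q := (p ^ t)%N.
Local Notation N := (p ^ T).-1.
Local Notation teich := (teich W T).
Local Notation cyc := (cyc p T).

Let T_gt0 : (0 < T)%N.
Proof. by rewrite muln_gt0. Qed.

Let N_gt0 : (0 < N)%N := N_gt0 p_pr cardF.

Lemma q_gt1 : (1 < q)%N.
Proof. by rewrite -(expn0 p) ltn_exp2l ?prime_gt1. Qed.

Lemma pred_exprq2 : (N = q.-1 * q.+1)%N.
Proof.
rewrite (_ : p ^ T = q * q)%N; last by rewrite -expnD addnn mul2n.
by case: (q) q_gt1 => //= k; nia.
Qed.

Lemma exprq2_modN x : (q * (q * x) = x %[mod N])%N.
Proof.
rewrite mulnA -expnD addnn -mul2n -[(p ^ T)%N](@prednK) ?expn_gt0 ?prime_gt0 //.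
by rewrite mulSn addnC mulnC modnMDl.
Qed.

Variables (J : finType) (a b d : J -> nat).

(* Summing over the powers p ^ l the inequalities that the exponents satisfy
   modulo N = q ^ 2 - 1 amounts to a comparison of digit sums. *)
Lemma weighted_cyc (e : J -> nat) (j0 : J) :
  (forall j, a j + b j + 2 * d j <= 4)%N ->
  (a j0 + b j0 + 2 * d j0 < 4)%N -> (0 < e j0)%N ->
  (q.-1 %| \sum_j e j)%N ->
  (N %| \sum_j (a j + q * b j) * e j)%N -> (0 < \sum_j (a j + q * b j) * e j)%N ->
  (q.-1 %| \sum_j d j * e j)%N -> (0 < \sum_j d j * e j)%N ->
  (2 * t * N <= \sum_j cyc (e j))%N.
Proof.
move=> wt wt0 e0_gt0 qE NM M_gt0 qD D_gt0.
pose X (l : nat) j := red N (p ^ l * e j).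
pose X' (l : nat) j := red N (p ^ l * (q * e j)).
(* Multiplication by [q] preserves [cyc], so the sum of these bounds over [l] reads
   [2 T N <= 2 * \sum_j cyc (e j)]. *)
suff bound (l : 'I_T) : (2 * N <= \sum_j (X l j + X' l j))%N.
  have : (\sum_(l < T) 2 * N <= \sum_(l < T) \sum_j (X l j + X' l j))%N.
    by apply: leq_sum => l _; exact: bound.
  rewrite sum_nat_const card_ord exchange_big /=.
  rewrite (eq_bigr (fun j => 2 * cyc (e j)))%N => [|j _].
    by rewrite -big_distrr /= mulnCA leq_mul2l.
  by rewrite big_split /= -/(cyc (e j)) -/(cyc (q * e j)) cycXp // addnn -mul2n.
have redX (w w' : J -> nat) j :
    (w j * X l j + w' j * X' l j = (w j + q * w' j) * (p ^ l * e j) %[mod N])%N.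
  rewrite -modnDm -[(w j * _ %% _)%N]modnMmr -[(w' j * _ %% _)%N]modnMmr !red_modn.
  rewrite !modnMmr modnDm; congr (_ %% _)%N; ring.
have dvdX (w w' : J -> nat) : (N %| \sum_j (w j + q * w' j) * e j)%N ->
    (N %| \sum_j (w j * X l j + w' j * X' l j))%N.
  move=> /(dvdn_mull (p ^ l)); rewrite big_distrr /= /dvdn -modn_summ => H.
  rewrite -modn_summ (eq_bigr (fun j => (p ^ l * ((w j + q * w' j) * e j)) %% N)%N) // => j _.
  by rewrite redX mulnCA.
have gtX (w w' : J -> nat) : (0 < \sum_j (w j + w' j) * e j)%N ->
    (0 < \sum_j (w j * X l j + w' j * X' l j))%N.
  rewrite lt0n sum_nat_eq0 negb_forall => /existsP[j].
  rewrite implyTb -lt0n muln_gt0 addn_gt0 => /andP[ww' e_gt0].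
  rewrite lt0n sum_nat_eq0 negb_forall; apply/existsP; exists j.
  rewrite implyTb -lt0n addn_gt0 !muln_gt0 !red_gt0 !muln_gt0 e_gt0.
  by rewrite !expn_gt0 (prime_gt0 p_pr) /= !andbT.
have gt_e (w w' : J -> nat) : (0 < \sum_j w j * e j)%N ->
    (forall j, 0 < w j -> 0 < w' j)%N -> (0 < \sum_j w' j * e j)%N.
  rewrite lt0n sum_nat_eq0 negb_forall => /existsP[j].
  rewrite implyTb -lt0n muln_gt0 => /andP[w_gt0 e_gt0] ww'.
  rewrite lt0n sum_nat_eq0 negb_forall; apply/existsP; exists j.
  by rewrite implyTb -lt0n muln_gt0 e_gt0 ww'.
have q_gt0 : (0 < q)%N by rewrite expn_gt0 prime_gt0.
(* [le1], [le2] and [le3] concern positive multiples of [N], congruent to [p ^ l] times [M], [q M]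
   and [(q + 1) D], where [M] and [D] are the total exponents of [y] and [r]. *)
have le1 : (N <= \sum_j (a j * X l j + b j * X' l j))%N.
  apply: dvdn_leq (dvdX _ _ NM); apply: gtX; apply: gt_e M_gt0 _ => j.
  by rewrite !addn_gt0 muln_gt0 q_gt0.
have le2 : (N <= \sum_j (b j * X l j + a j * X' l j))%N.
  apply: dvdn_leq; first by apply: gtX; apply: gt_e M_gt0 _ => j; rewrite !addn_gt0 muln_gt0 q_gt0 orbC.
  apply: dvdX; move: (dvdn_mull q NM); rewrite big_distrr /= /dvdn -modn_summ => H.
  rewrite -modn_summ (eq_bigr (fun j => (q * ((a j + q * b j) * e j)) %% N)%N) // => j _.
  rewrite !mulnDl mulnDr [in RHS]addnC -mulnA -modnDml -[in RHS]modnDml.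
  by rewrite -[(q * b j * e j)%N]mulnA exprq2_modN mulnA.
have qdvd (w : J -> nat) : (q.-1 %| \sum_j w j * e j)%N ->
    (N %| \sum_j (w j + q * w j) * e j)%N.
  move=> qw; rewrite (eq_bigr (fun j => q.+1 * (w j * e j))%N) => [|j _]; last by ring.
  by rewrite -big_distrr /= pred_exprq2 mulnC dvdn_mul.
have le3 : (N <= \sum_j (d j * X l j + d j * X' l j))%N.
  apply: dvdn_leq (dvdX _ _ (qdvd _ qD)).
  by apply: gtX; apply: gt_e D_gt0 _ => j; rewrite addn_gt0 orbb.
have dvdS : (N %| \sum_j (X l j + X' l j))%N.
  rewrite (eq_bigr (fun j => 1 * X l j + 1 * X' l j))%N => [|j _]; last by rewrite !mul1n.
  apply: (dvdX (fun=> 1%N) (fun=> 1%N)); apply: (qdvd (fun=> 1%N)).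
  by under eq_bigr do rewrite mul1n.
(* Adding [le1], [le2] and twice [le3] bounds the weighted sum below by [4 N]. All weights are at
   most 4 and that of [j0] is smaller, so the unweighted sum exceeds [N]; being a multiple of [N],
   it is at least [2 N]. *)
have lt4 : (4 * N < 4 * \sum_j (X l j + X' l j))%N.
  apply: (@leq_ltn_trans (\sum_j (a j + b j + 2 * d j) * (X l j + X' l j))%N).
    rewrite (eq_bigr (fun j => (a j * X l j + b j * X' l j) + (b j * X l j + a j * X' l j)
      + 2 * (d j * X l j + d j * X' l j))%N) => [|j _]; last by ring.
    rewrite big_split [X in (_ <= X + _)%N]big_split -big_distrr /=.
    by move: le1 le2 le3; lia.
  rewrite big_distrr /= (bigD1 j0) //= [in X in (_ < X)%N](bigD1 j0) //= -addSn.
  apply: leq_add; last by apply: leq_sum => j _; rewrite leq_mul2r wt orbT.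
  rewrite ltn_pmul2r // addn_gt0 red_gt0 muln_gt0 e0_gt0 expn_gt0 prime_gt0 //.
case/dvdnP: dvdS lt4 => k ->.
by case: k => [|[|k]]; nia.
Qed.

(** [y] ranges over [F] and [r] over GF(q); [a j] and [b j] are the degrees in [y] and in [y ^+ q],
    treated as two variables. *)
Definition wpoly (c : J -> F) (y r : F) : F :=
  \sum_j c j * y ^+ (a j + q * b j) * r ^+ d j.

(** Orthogonality over GF(q), whose multiplicative group is generated by [th ^+ q.+1]. *)
Lemma sum_teich_q m : ~~ (q.-1 %| m)%N -> \sum_(r | r ^+ q == r) teich r ^+ m = 0.
Proof.
move=> qm; have [th th0 thE] := generator_order cardF.
pose u := th ^+ q.+1.
have u0 : u != 0 by rewrite expf_neq0.
have uq : u ^+ q = u.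
  apply: (mulIf u0); rewrite -exprSr -expr2 -!exprM.
  have -> : (q.+1 * q.+1 = N + q.+1 * 2)%N.
    by rewrite pred_exprq2; have := q_gt1; move: (q) => [|x] //=; nia.
  by rewrite exprD (eqP (_ : th ^+ N == 1)) ?mul1r // thE.
apply: (@sum_twist _ _ _ W _ p_pr cardF _ [pred r : F | r ^+ q == r]
  ( *%R u) _ (teich u ^+ m)).
- exact: mulfI.
- by move=> x; rewrite !inE exprMn uq (inj_eq (mulfI u0)).
- by move=> x _; rewrite teichM // exprMn.
rewrite rmorphXn /= teichK // -exprM thE pred_exprq2 mulnC dvdn_pmul2l //.
Qed.

(** Monomials with exponents supported in [top] cancel between [f] and [g]. For any other, either
    its sum vanishes, or one of [y] and [r] is absent and summing over it gives a factor [q], or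
    [weighted_cyc] makes the digit sums so large that [q] divides the multinomial coefficient. *)
Lemma weighted_ax (c : J -> F) (top : {pred J}) :
  (t <= K)%N -> (q %| #|[set r : F | (r ^+ q == r)%R]|)%N ->
  (forall j, a j + b j + 2 * d j <= 4)%N ->
  (forall j, j \notin top -> a j + b j + 2 * d j < 4)%N ->
  let f := wpoly c in
  let g := wpoly (fun j => if j \in top then c j else 0) in
  (forall y r, r ^+ q = r -> f y r = 0 \/ f y r ^+ q.-1 = 1) ->
  (forall y r, r ^+ q = r -> g y r = 0 \/ g y r ^+ q.-1 = 1) ->
  pdiv t (#|[set yr : F * F | (yr.2 ^+ q == yr.2) && (f yr.1 yr.2 == 0)]|%:R -
          #|[set yr : F * F | (yr.2 ^+ q == yr.2) && (g yr.1 yr.2 == 0)]|%:R : W).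
Proof.
move=> letK qFq wt wt_top f g f1 g1.
have q1_gt0 : (0 < q.-1)%N by rewrite -ltnS prednK ?q_gt1 // ltnW ?q_gt1.
pose mon j (y r : F) := c j * y ^+ (a j + q * b j) * r ^+ d j.
(* The boolean selects [f] (all monomials, sign -1) or [g] (those of [top], sign 1), so that one
   power sum expresses the difference of the two counts. *)
pose x (P : F * F * bool) j := if P.2 || (j \in top) then mon j P.1.1 P.1.2 else 0.
pose s (P : F * F * bool) : W :=
  (P.1.2 ^+ q == P.1.2)%:R * (if P.2 then -1 else 1).
have -> : #|[set yr : F * F | (yr.2 ^+ q == yr.2) && (f yr.1 yr.2 == 0)]|%:R -
          #|[set yr : F * F | (yr.2 ^+ q == yr.2) && (g yr.1 yr.2 == 0)]|%:R =
    \sum_P s P * (\sum_j teich (x P j)) ^+ (q.-1 * p ^ K) :> W.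
  rewrite -!sum1_card !natr_sum !(big_mkcond (fun yr => yr \in _)) -sumrB.
  rewrite [RHS]big_pairE; apply: eq_bigr => -[y r] _; rewrite big_bool /s /x /= !inE /=.
  have [rq | _] := eqVneq; last by rewrite !mul0r addr0 subrr.
  rewrite !(teich_sum W p_pr cardF q1_gt0 (leqnn K)); last 2 first.
  - have := g1 y r rq; rewrite /g /wpoly.
    by under eq_bigr do rewrite -mulrA (fun_if (fun z => z * _)) mul0r mulrA.
  - exact: f1.
  rewrite -/(f y r).
  have -> : \sum_j (if j \in top then mon j y r else 0) = g y r.
    by apply: eq_bigr => j _; case: ifP => //; rewrite !mul0r.
  by rewrite !mul1r mulN1r; do 2![case: (_ == 0)] => /=; ring.
apply: sum_expr_ind; [exact: pdiv0 | exact: pdivD |] => e m sum_e mE.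
rewrite big_pairE.
have [/existsP[j0 /andP[top0 e0]] | no_j0] :=
    boolP [exists j, (j \notin top) && (0 < e j)%N]; last first.
  rewrite big1 ?mulr0; first exact: pdiv0.
  move=> [y r] _; rewrite big_bool /= /s /= !mulrN !mulr1 mulNr.
  rewrite [X in _ + X](_ : _ = (r ^+ q == r)%:R * \prod_j teich (x (y, r, true) j) ^+ e j).
    by rewrite addNr.
  congr (_ * _); apply: eq_bigr => j _; rewrite /x /=; case: ifP => // /negbT jtop.
  move: no_j0; rewrite negb_exists => /forallP/(_ j); rewrite jtop /= -eqn0Ngt => /eqP->.
  by rewrite !expr0.
pose M := (\sum_j (a j + q * b j) * e j)%N; pose D := (\sum_j d j * e j)%N.
have -> : \sum_(yr : F * F) \sum_(i : bool) s (yr, i) * \prod_j teich (x (yr, i) j) ^+ e j =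
   - (\prod_j teich (c j) ^+ e j) * ((\sum_y teich y ^+ M) * \sum_(r | r ^+ q == r) teich r ^+ D).
  rewrite big_distrl big_distrr /= big_pairE; apply: eq_bigr => y _.
  rewrite mulr_sumr big_distrr [RHS]big_mkcond; apply: eq_bigr => r _ /=.
  rewrite big_bool /= [X in _ + X](_ : _ = 0) ?addr0 /s /=; last first.
    rewrite (bigD1 j0) //= /x /= (negPf top0) teich0 // expr0n gtn_eqF //.
    by rewrite mul0r mulr0.
  case: (_ == _); rewrite ?mul0r // mul1r mulN1r mulNr; congr (- _).
  rewrite /M /D -!prodrXr -!big_split; apply: eq_bigr => j _ /=.
  by rewrite /x /mon /= !teichM // !teichX // !exprMn -!exprM mulrA.
rewrite mulrCA; apply: pdivMl.
have [M0 | M_gt0] := posnP M.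
  rewrite M0; under eq_bigr do rewrite expr0.
  rewrite sumr_const cardF; apply: pdivMl; apply: pdivMr; apply: pdiv_nat.
  by rewrite dvdn_exp2l // leq_pmull.
have [D0 | D_gt0] := posnP D.
  do 2!apply: pdivMl; rewrite D0; under eq_bigr do rewrite expr0.
  rewrite sumr_const; apply: pdiv_nat.
  by move: qFq; congr (_ %| _)%N; apply: eq_card => r; rewrite !inE.
have [NM | NM] := boolP (N %| M)%N; last first.
  by rewrite sum_teich // mul0r mulr0; exact: pdiv0.
have [qD | qD] := boolP (q.-1 %| D)%N; last first.
  by rewrite sum_teich_q // !mulr0; exact: pdiv0.
apply: pdivMr; apply: pdiv_nat.
have m_gt0 : (0 < m)%N.
  by have := fact_gt0 (q.-1 * p ^ K); rewrite -mE muln_gt0 => /andP[].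
rewrite pfactor_dvdn //.
have qE : (q.-1 %| \sum_j e j)%N by rewrite sum_e dvdn_mulr.
have cyc_ge := weighted_cyc wt (wt_top _ top0) e0 qE NM M_gt0 qD D_gt0.
have cyc_le := logn_multinomial p_pr T_gt0 sum_e mE.
by rewrite -(leq_pmul2l N_gt0); move: cyc_ge cyc_le; lia.
Qed.

End WeightedAx.

(** * Buekenhout-Metz unitals *)

Lemma row3E (F : finFieldType) (x y z : F) (i : 'I_3) :
  row3 x y z 0 i = if i == i0 then x else if i == i1 then y else z.
Proof. by rewrite mxE. Qed.

Lemma normalized_scale (F : finFieldType) (P Q : point F) (c : F) :
  val P = c *: val Q -> P = Q.
Proof.
move=> PQ; apply: val_inj => /=; suff c1 : c = 1 by rewrite PQ c1 scale1r.
have z1 : (0 == 1 :> F) = false by rewrite eq_sym oner_eq0.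
have c0 : (c == 0) = false.
  apply/eqP => c0; have := valP P; rewrite /normalized PQ c0 scale0r !mxE.
  by rewrite eqxx z1.
have := valP P; rewrite /normalized PQ !mxE.
case/orP: (valP Q) => [/eqP-> | /andP[/eqP-> /orP[/eqP-> | /andP[/eqP-> /eqP->]]]];
  by rewrite ?mulr1 ?mulr0 ?z1 ?eqxx ?c0 ?orbF => /eqP.
Qed.

Section BuekenhoutMetz.
Variables (p t : nat) (F : finFieldType).
Hypotheses (p_pr : prime p) (t_gt0 : (0 < t)%N) (cardF : #|F| = (p ^ (2 * t))%N).

Local Notation T := (2 * t)%N.
Local Notation q := (p ^ t)%N.

Variables alpha beta : F.

Definition bm_quad (y : F) : F := alpha * y ^+ 2 + beta * y ^+ q.+1.

Local Notation BM := (BM_set q alpha beta).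
Hypothesis BM_unital : is_unital q BM.

Lemma normalized_affine (y z : F) : normalized (row3 1 y z).
Proof. by rewrite /normalized !row3E /= eqxx. Qed.

Lemma normalized_infty : normalized (row3 0 0 1 : 'rV[F]_3).
Proof. by rewrite /normalized !row3E /= !eqxx !orbT. Qed.

Definition affine (y z : F) : point F := Sub (row3 1 y z) (normalized_affine y z).
Definition infty : point F := Sub (row3 0 0 1) normalized_infty.

Definition bm_point (yr : F * F) : point F := affine yr.1 (bm_quad yr.1 + yr.2).

Lemma bm_point_inj : injective bm_point.
Proof.
move=> [y r] [y' r'] /(congr1 val) /= /rowP e.
have := e i1; rewrite !row3E /= => ey; have := e i2; rewrite !row3E /= ey.
by move/addrI->.
Qed.

Lemma bm_point_infty yr : bm_point yr != infty.
Proof.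
apply/eqP => /(congr1 val) /= /rowP/(_ i0); rewrite !row3E /= => /eqP.
by rewrite oner_eq0.
Qed.

Lemma BM_setE : BM = infty |: [set bm_point yr | yr in [pred yr : F * F | yr.2 ^+ q == yr.2]].
Proof.
apply/setP=> P; rewrite !inE; congr (_ || _).
apply/existsP/imsetP => [[y /existsP[r /andP[rq /eqP PE]]] | [[y r] rq ->]].
  by exists (y, r); rewrite ?inE //; apply: val_inj.
by exists y; apply/existsP; exists r; move: rq; rewrite inE /= => -> /=.
Qed.

Lemma card_BM (A : pred (point F)) :
  #|[set P in BM | A P]| =
  (A infty + #|[set yr : F * F | (yr.2 ^+ q == yr.2) && A (bm_point yr)]|)%N.
Proof.
rewrite (cardsD1 infty) !inE eqxx /=; congr (_ + _)%N.
rewrite -(card_imset _ bm_point_inj); apply: eq_card => P.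
rewrite BM_setE !inE; apply/andP/imsetP.
  case=> /negPf -> /= /andP[/imsetP[yr yrq ->] AP]; exists yr => //.
  by rewrite inE AP andbT.
case=> yr; rewrite inE => /andP[yrq AP] ->; rewrite bm_point_infty; split => //.
by rewrite AP orbC imset_f.
Qed.

Let q_gt0 : (0 < q)%N.
Proof. by rewrite expn_gt0 prime_gt0. Qed.

(** Read off from the size [q ^ 3 + 1] of the unital: besides [infty] there are [#|F| = q ^ 2]
    points for each [r]. *)
Lemma card_Fq : #|[set r : F | (r ^+ q == r)%R]| = q.
Proof.
have [+ _] := BM_unital; have := card_BM predT.
have -> : [set P in BM | predT P] = BM by apply/setP=> P; rewrite !inE andbT.
move=> -> /eqP; rewrite addnC eqn_add2r.
have -> : [set yr : F * F | (yr.2 ^+ q == yr.2) && predT (bm_point yr)] =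
   setX [set: F] [set r : F | r ^+ q == r] by apply/setP=> yr; rewrite !inE andbT.
rewrite cardsX cardsT cardF (_ : p ^ T = q * q)%N; last by rewrite -expnD addnn mul2n.
by rewrite !expnS expn0 muln1 mulnA eqn_pmul2l ?muln_gt0 ?q_gt0 // => /eqP.
Qed.

(** The line [z = 0] is tangent at [(1, 0, 0)]. The solutions [y] of the hypothesis form a set [S]
    of 1 or [q + 1] elements stable under GF(q). A nonzero [y0] would put its [q] multiples in [S],
    leaving a single further element [y1]; but for [q > 2] a scalar [u] other than 0 and 1 moves
    [y1] to yet another one. *)
Lemma bm_quad_line (y0 : F) : (2 < q)%N -> bm_quad y0 ^+ q = bm_quad y0 -> y0 = 0.
Proof.
move=> q_gt2 y0q; apply/eqP; apply: contraT => y0n0.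
pose S := [set y : F | bm_quad y ^+ q == bm_quad y].
pose Fq := [set r : F | r ^+ q == r].
have S_scale r y : r \in Fq -> y \in S -> r * y \in S.
  rewrite !inE => /eqP rq /eqP yq.
  have -> : bm_quad (r * y) = r ^+ 2 * bm_quad y.
    rewrite /bm_quad !exprMn [r ^+ q.+1]exprS rq; ring.
  by rewrite exprMn yq exprAC rq.
have cardS : #|S| = 1%N \/ #|S| = q.+1.
  (* As dual coordinates, [infty] is the line [z = 0]; it meets the unital in the points with
     [r = - bm_quad y]. *)
  have [_ /(_ infty)] := BM_unital.
  rewrite card_BM (_ : incident infty infty = false) ?add0n; last first.
    rewrite /incident !big_ord_recl big_ord0 !row3E /= !mulr0 !mulr1 !add0r addr0.
    exact: negbTE (oner_neq0 _).
  suff -> : #|[set yr : F * F | (yr.2 ^+ q == yr.2) && incident (bm_point yr) infty]| = #|S| by [].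
  pose g y := (y, - bm_quad y).
  have g_inj : injective g by move=> y y' [].
  rewrite -(card_imset _ g_inj); apply: eq_card => -[y r]; rewrite inE /=.
  have -> : incident (bm_point (y, r)) infty = (r == - bm_quad y).
    rewrite /incident !big_ord_recl big_ord0 !row3E /= !mulr0 !mulr1 !add0r addr0.
    by rewrite addrC addr_eq0.
  have qN (x : F) : (- x) ^+ q = - x ^+ q.
    apply/eqP; by rewrite -addr_eq0 -(exprDq p_pr cardF) addNr expr0n gtn_eqF.
  apply/andP/imsetP => [[rq /eqP rE] | [y' y'S [-> ->]]].
    by exists y; rewrite /g -?rE // inE -eqr_opp -qN -rE.
  by split=> //; move: y'S; rewrite inE qN eqr_opp.
have y0S : y0 \in S by rewrite inE y0q.
have S0 : 0 \in S by rewrite inE /bm_quad !expr0n /= !mulr0 addr0 expr0n gtn_eqF.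
pose L := [set r * y0 | r in Fq].
have mul_inj : injective (fun r => r * y0) by apply: mulIf.
have cardL : #|L| = q by rewrite card_imset // card_Fq.
have LS : L \subset S by apply/subsetP => _ /imsetP[r rq ->]; apply: S_scale.
have {}cardS : #|S| = q.+1.
  by case: cardS => // cS; have := subset_leq_card LS; rewrite cS cardL; lia.
have /cards1P[y1 SLE] : #|S :\: L| == 1%N.
  by rewrite cardsD (setIidPr LS) cardS cardL subSnn.
have /setDP[y1S y1L] : y1 \in S :\: L by rewrite SLE set11.
have [u /setD1P[u1 /setD1P[u0 uFq]]] : exists u, u \in Fq :\ 0 :\ 1.
  apply/set0Pn; rewrite -card_gt0; have := cardsD1 1 (Fq :\ 0); have := cardsD1 0 Fq.
  rewrite card_Fq; move: #|_ :\ 1| #|_ :\ 0| q_gt2 => n1 n0.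
  by case: (0 \in Fq); case: (1 \in _) => /=; lia.
have : u * y1 \in S :\: L.
  rewrite inE S_scale // andbT; apply: contra y1L => /imsetP[r rq ury].
  apply/imsetP; exists (u^-1 * r); last by rewrite -mulrA -ury mulKf.
  by move: rq uFq; rewrite !inE exprMn exprVn => /eqP-> /eqP->.
rewrite SLE inE -[X in _ == X]mul1r => /eqP/mulIf uy.
have y10 : y1 != 0.
  apply: contra y1L => /eqP->; apply/imsetP; exists 0; rewrite ?mul0r //.
  by rewrite inE expr0n gtn_eqF.
by case/eqP: u1; apply: uy.
Qed.

End BuekenhoutMetz.

Lemma pdiv_modn (p K : nat) (F : finFieldType) (W : galois_ring F p K) k m n :
  prime p -> (k <= K)%N -> pdiv k (m%:R - n%:R : W) -> (m = n %[mod p ^ k])%N.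
Proof.
move=> p_pr lekK; wlog lenm : m n / (n <= m)%N => [H | mn].
  have [/H // | /ltnW/H H'] := leqP n m => mn; apply/esym/H'.
  by rewrite -opprB -mulN1r; apply: pdivMl.
by apply/eqP; rewrite eqn_mod_dvd // (@pdiv_natE _ _ _ W p_pr _ _ lekK) // natrB.
Qed.

(** * The congruence for a Buekenhout-Metz unital in normal form *)

Section BuekenhoutMetzHermitian.
Variables (p t : nat) (F : finFieldType).
Hypotheses (p_pr : prime p) (t_gt0 : (0 < t)%N) (cardF : #|F| = (p ^ (2 * t))%N).

Local Notation q := (p ^ t)%N.

Variables alpha beta : F.

(* The coordinates (1, y, alpha y^2 + beta y^(q+1) + r) of an affine point are
   sums of the five monomials 1, y, alpha y^2, beta y^(q+1), r; the row of a
   monomial is also its degree when y has weight 1 and r has weight 2. *)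
Definition bm_row (k : 'I_5) : 'I_3 := nth i2 [:: i0; i1] k.
Definition bm_coef (k : 'I_5) : F := nth 0 [:: 1; 1; alpha; beta; 1] k.
Definition bm_a (k : 'I_5) : nat := nth 0%N [:: 0; 1; 2; 1; 0]%N k.
Definition bm_b (k : 'I_5) : nat := nth 0%N [:: 0; 0; 0; 1; 0]%N k.
Definition bm_d (k : 'I_5) : nat := nth 0%N [:: 0; 0; 0; 0; 1]%N k.

Definition bm_mon (k : 'I_5) (y r : F) : F :=
  bm_coef k * y ^+ (bm_a k + q * bm_b k) * r ^+ bm_d k.

Lemma bm_weight k : (bm_a k + bm_b k + 2 * bm_d k = bm_row k)%N.
Proof. by case: k => [[|[|[|[|[|]]]]]]. Qed.

Lemma bm_coordE y r i :
  row3 1 y (bm_quad p t alpha beta y + r) 0 i = \sum_(k | bm_row k == i) bm_mon k y r.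
Proof.
rewrite row3E big_mkcond !big_ord_recl big_ord0 /bm_mon /bm_row /bm_coef /bm_a /bm_b /bm_d /=.
rewrite ?muln0 ?muln1 ?addn0 ?add0n ?add1n ?expr0 ?expr1 ?mulr1 ?mul1r /bm_quad.
have : [|| i == i0, i == i1 | i == i2] by case: i => [[|[|[]]]].
by case/or3P => /eqP-> /=; rewrite ?add0r ?addr0 ?addrA.
Qed.

Definition bm_c (A : 'M[F]_3) (kl : 'I_5 * 'I_5) : F :=
  A (bm_row kl.1) (bm_row kl.2) * bm_coef kl.1 * bm_coef kl.2 ^+ q.

(** As [y ^+ (q * q) = y] and [r ^+ q = r], conjugating the second monomial exchanges its degrees
    [bm_a] and [bm_b] and keeps [bm_d]. *)
Lemma bm_c_mon (A : 'M[F]_3) y r kl : r ^+ q = r ->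
  bm_c A kl * y ^+ ((bm_a kl.1 + bm_b kl.2) + q * (bm_b kl.1 + bm_a kl.2)) *
    r ^+ (bm_d kl.1 + bm_d kl.2) =
  A (bm_row kl.1) (bm_row kl.2) * bm_mon kl.1 y r * bm_mon kl.2 y r ^+ q.
Proof.
move=> rq; rewrite /bm_c /bm_mon !exprMn [(r ^+ _) ^+ q]exprAC rq.
have -> : (y ^+ (bm_a kl.2 + q * bm_b kl.2)) ^+ q = y ^+ (bm_b kl.2 + q * bm_a kl.2).
  rewrite !exprD exprMn [in RHS]mulrC; congr (_ * _); first by rewrite -exprM mulnC.
  by rewrite exprM !(exprAC _ q) (expr_qq cardF).
by rewrite !mulnDr !exprD; ring.
Qed.

Local Notation bm_poly c := (wpoly p t (fun kl => bm_a kl.1 + bm_b kl.2)%N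
  (fun kl => bm_b kl.1 + bm_a kl.2)%N (fun kl => bm_d kl.1 + bm_d kl.2)%N c).

Lemma bm_poly_herm (A : 'M[F]_3) y r : r ^+ q = r ->
  bm_poly (bm_c A) y r = herm_value q A (row3 1 y (bm_quad p t alpha beta y + r)).
Proof.
move=> rq; rewrite herm_valueE big_pairE.
have -> : bm_poly (bm_c A) y r =
    \sum_k \sum_l A (bm_row k) (bm_row l) * bm_mon k y r * bm_mon l y r ^+ q.
  by rewrite /wpoly big_pairE; do 2!apply: eq_bigr => ? _; rewrite bm_c_mon.
rewrite (partition_big bm_row predT) //=; apply: eq_bigr => i _.
transitivity (\sum_j \sum_(k | bm_row k == i) \sum_(l | bm_row l == j)
    A i j * bm_mon k y r * bm_mon l y r ^+ q).
  rewrite [RHS]exchange_big; apply: eq_bigr => k /eqP ki.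
  rewrite (partition_big bm_row predT) //=; apply: eq_bigr => j _.
  by apply: eq_bigr => l /eqP lj; rewrite ki lj.
apply: eq_bigr => j _; rewrite !bm_coordE (expr_sumq p_pr cardF).
under eq_bigr do rewrite -mulr_sumr.
by rewrite -mulr_suml -mulr_sumr.
Qed.

Definition bm_top : pred ('I_5 * 'I_5) :=
  [pred kl | (bm_row kl.1 == i2) && (bm_row kl.2 == i2)].

Lemma bm_poly_top (A : 'M[F]_3) y r : r ^+ q = r ->
  bm_poly (fun kl => if kl \in bm_top then bm_c A kl else 0) y r =
  A i2 i2 * (bm_quad p t alpha beta y + r) ^+ q.+1.
Proof.
move=> rq; have zE : bm_quad p t alpha beta y + r = \sum_(k | bm_row k == i2) bm_mon k y r.
  by rewrite -bm_coordE row3E.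
rewrite exprS mulrA {2}zE (expr_sumq p_pr cardF) zE.
rewrite [X in _ = X * _]mulr_sumr mulr_suml.
rewrite /wpoly big_pairE [RHS]big_mkcond; apply: eq_bigr => k _.
case: ifP => [/eqP ki | ki]; last first.
  by rewrite big1 // => l _; rewrite inE /= ki /= !mul0r.
rewrite mulr_sumr [RHS]big_mkcond; apply: eq_bigr => l _.
rewrite inE /= ki eqxx /=; case: ifP => [/eqP li | _]; last by rewrite !mul0r.
by rewrite bm_c_mon //= ki li.
Qed.

(** Modulo [q], the affine zeros may be counted for the weight 4 part [A i2 i2 * z ^+ q.+1] alone.
    If [A i2 i2 = 0], then [infty] lies on the Hermitian curve and all [q ^ 3] affine points count;
    otherwise [infty] does not, and [bm_quad_line] leaves only [y = r = 0]. *)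
Lemma bm_herm_mod (A : 'M[F]_3) : (2 < q)%N -> is_unital q (BM_set q alpha beta) ->
  Defs.hermitian_matrix q A ->
  (#|[set P in BM_set q alpha beta | herm_value q A (val P) == 0%R]| = 1 %[mod q])%N.
Proof.
move=> q_gt2 BM_unital hA.
have q_gt0 : (0 < q)%N by exact: ltn_trans q_gt2.
have [W] := galois_ring_exists (pcharF p_pr cardF) t_gt0.
have qFq : (q %| #|[set r : F | (r ^+ q == r)%R]|)%N by rewrite (card_Fq p_pr cardF BM_unital).
have A22q : A i2 i2 ^+ q = A i2 i2.
  by case/andP: hA => /eqP/matrixP/(_ i2 i2); rewrite !mxE /conjq.
have wt kl : (bm_a kl.1 + bm_b kl.2 + (bm_b kl.1 + bm_a kl.2) + 2 * (bm_d kl.1 + bm_d kl.2)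
              = bm_row kl.1 + bm_row kl.2)%N.
  by rewrite -!bm_weight; lia.
have wt4 kl : (bm_a kl.1 + bm_b kl.2 + (bm_b kl.1 + bm_a kl.2) + 2 * (bm_d kl.1 + bm_d kl.2)
              <= 4)%N.
  by rewrite wt; have := ltn_ord (bm_row kl.1); have := ltn_ord (bm_row kl.2); lia.
have wt_top kl : kl \notin bm_top ->
    (bm_a kl.1 + bm_b kl.2 + (bm_b kl.1 + bm_a kl.2) + 2 * (bm_d kl.1 + bm_d kl.2) < 4)%N.
  rewrite wt inE -!val_eqE /=; have := ltn_ord (bm_row kl.1); have := ltn_ord (bm_row kl.2).
  by lia.
have f1 y r : r ^+ q = r -> bm_poly (bm_c A) y r = 0 \/ bm_poly (bm_c A) y r ^+ q.-1 = 1.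
  by move=> rq; rewrite bm_poly_herm //; apply: herm_value_expr.
have g1 y r : r ^+ q = r -> let g := bm_poly (fun kl => if kl \in bm_top then bm_c A kl else 0) y r in
    g = 0 \/ g ^+ q.-1 = 1.
  move=> rq /=; rewrite bm_poly_top //; set z := (_ + r).
  have [-> | g0] := eqVneq (A i2 i2 * z ^+ q.+1) 0; [by left | right].
  apply: (mulfI g0); rewrite mulr1 -exprS prednK // exprMn A22q; congr (_ * _).
  by rewrite exprS exprMn (expr_qq cardF) mulrC.
have := weighted_ax W p_pr t_gt0 cardF (leqnn t) qFq wt4 wt_top f1 g1.
rewrite (card_BM p t alpha beta (fun P => herm_value q A (val P) == 0)) /=.
pose n1 := #|[set yr : F * F | (yr.2 ^+ q == yr.2) &&
  (herm_value q A (val (bm_point p t alpha beta yr)) == 0%R)]|.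
rewrite -/n1; set n2 := #|_|; set n3 := #|_|.
have <- : n1 = n2.
  apply: eq_card => yr; rewrite !inE /=; case: eqP => //= rq.
  by rewrite bm_poly_herm.
move/(pdiv_modn p_pr (leqnn t)) => e13; rewrite -modnDmr e13 modnDmr.
have -> : herm_value q A (val (infty F)) = A i2 i2.
  rewrite herm_valueE (bigD1 (i2, i2)) //= !row3E /= expr1n !mulr1.
  rewrite big1 ?addr0 // => -[i j]; rewrite xpair_eqE negb_and.
  have H k : k != i2 -> row3 0 0 1 0 k = 0 :> F.
    by move=> /negPf k2; rewrite row3E; case: k k2 => [[|[|[]]]].
  case/orP => /H /= ->; first by rewrite mulr0 mul0r.
  by rewrite expr0n gtn_eqF // mulr0.
have [A0 | A0] := eqVneq (A i2 i2) 0.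
  have -> : n3 = (q * q * q)%N; last by rewrite addnC modnMDl.
  have -> : n3 = #|setX [set: F] [set r : F | r ^+ q == r]|.
    apply: eq_card => yr; rewrite !inE /=; case: eqP => //= rq.
    by rewrite bm_poly_top // A0 mul0r eqxx.
  rewrite cardsX cardsT cardF (card_Fq p_pr cardF BM_unital); congr (_ * _)%N.
  by rewrite -expnD addnn mul2n.
have -> : n3 = 1%N; last by rewrite add0n.
apply/eqP/cards1P; exists (0, 0); apply/setP=> -[y r]; rewrite !inE xpair_eqE /=.
have [rq | rq] := eqVneq (r ^+ q) r; last first.
  apply/esym; apply: contraNF rq => /andP[_ /eqP->].
  by rewrite expr0n gtn_eqF.
rewrite bm_poly_top // mulf_eq0 (negPf A0) expf_eq0 /=.
apply/eqP/andP => [z0 | [/eqP-> /eqP->]]; last first.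
  by rewrite /bm_quad !expr0n /= !mulr0 !addr0.
have y0 : y = 0.
  apply: (bm_quad_line p_pr t_gt0 cardF BM_unital q_gt2).
  have -> : bm_quad p t alpha beta y = - r by apply/eqP; rewrite -addr_eq0 z0.
  apply/eqP; rewrite -addr_eq0 -[X in _ + X]rq.
  by rewrite -(exprDq p_pr cardF) addNr expr0n gtn_eqF.
move: z0; rewrite y0 /bm_quad !expr0n /= !mulr0 !add0r => ->.
by rewrite !eqxx.
Qed.

End BuekenhoutMetzHermitian.

(** * Projectivities *)

Section Projectivity.
Variables (p t : nat) (F : finFieldType).
Hypotheses (p_pr : prime p) (t_gt0 : (0 < t)%N) (cardF : #|F| = (p ^ (2 * t))%N).
Local Notation q := (p ^ t)%N.
Local Notation conj := (map_mx (conjq q)).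

Lemma conj_mxM m n r (M : 'M[F]_(m, n)) (M' : 'M[F]_(n, r)) :
  conj (M *m M') = conj M *m conj M'.
Proof.
apply/matrixP => i j; rewrite !mxE /conjq (expr_sumq p_pr cardF).
by apply: eq_bigr => k _; rewrite !mxE exprMn.
Qed.

Lemma conj_mxK m n : involutive (map_mx (conjq q) : 'M[F]_(m, n) -> 'M[F]_(m, n)).
Proof. by move=> M; apply/matrixP => i j; rewrite !mxE /conjq (expr_qq cardF). Qed.

Lemma conj_mx_unit (M : 'M[F]_3) : M \in unitmx -> conj M \in unitmx.
Proof.
move=> M_unit; have [] // := @mulmx1_unit _ _ (conj M) (conj (invmx M)).
rewrite -conj_mxM mulmxV //; apply/matrixP => i j; rewrite !mxE /conjq.
by case: (_ == _); rewrite ?expr1n // expr0n expn_eq0 (gtn_eqF (prime_gt0 p_pr)).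
Qed.

Definition herm_pullback (M A : 'M[F]_3) : 'M[F]_3 := M *m A *m (conj M)^T.

Lemma herm_value_mul (M A : 'M[F]_3) v :
  herm_value q A (v *m M) = herm_value q (herm_pullback M A) v.
Proof. by rewrite /herm_value /herm_pullback conj_mxM trmx_mul !mulmxA. Qed.

Lemma herm_pullback_hermitian (M A : 'M[F]_3) : M \in unitmx ->
  Defs.hermitian_matrix q A -> Defs.hermitian_matrix q (herm_pullback M A).
Proof.
move=> M_unit /andP[/eqP AT A_unit]; apply/andP; split.
  by rewrite /herm_pullback !trmx_mul trmxK AT !conj_mxM map_trmx conj_mxK mulmxA.
by rewrite !unitmx_mul unitmx_tr M_unit A_unit conj_mx_unit.
Qed.

Lemma herm_value_scale (A : 'M[F]_3) c v :
  herm_value q A (c *: v) = c ^+ q.+1 * herm_value q A v.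
Proof.
rewrite !herm_valueE mulr_sumr; apply: eq_bigr => ij _; rewrite !mxE exprMn exprS.
by ring.
Qed.

Lemma point_neq0 (P : point F) : val P != 0.
Proof.
apply/eqP => P0; have := valP P; rewrite /normalized P0 !mxE.
by rewrite eqxx !(eq_sym 0) oner_eq0.
Qed.

(** [M] induces an injection [phi] of the points. Passing to normalized representatives scales the
    form by a nonzero [c ^+ q.+1], which preserves its zeros. *)
Lemma card_proj_image (M A : 'M[F]_3) (S : {set point F}) : M \in unitmx ->
  #|[set P | herm_value q A (val P) == 0] :&: proj_image M S| =
  #|[set P in S | herm_value q (herm_pullback M A) (val P) == 0]|.
Proof.
move=> M_unit.
have imP (P : point F) : exists Q : point F,
    [exists c : F, (c != 0) && (val P *m M == c *: val Q)].
  have [|Q [c [c0 QE]]] := @point_of_row F (val P *m M).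
    apply: contra (point_neq0 P) => /eqP/(congr1 (mulmx^~ (invmx M))).
    by rewrite mulmxK // mul0mx => /eqP.
  by exists Q; apply/existsP; exists c; rewrite c0 QE eqxx.
pose phi P := xchoose (imP P).
have phiP P : exists2 c : F, c != 0 & val P *m M = c *: val (phi P).
  by have /existsP[c /andP[c0 /eqP]] := xchooseP (imP P); exists c.
have phi_inj : injective phi.
  move=> P P' ephi; have [c c0 cE] := phiP P; have [c' c'0 cE'] := phiP P'.
  apply: (@normalized_scale _ _ _ (c / c')); apply: (can_inj (mulmxK M_unit)).
  by rewrite -scalemxAl cE cE' ephi scalerA divfK.
rewrite -[RHS](card_imset _ phi_inj); apply: eq_card => Q; rewrite !inE.
apply/andP/imsetP => [[hQ /existsP[P /andP[PS /existsP[c /andP[c0 /eqP QE]]]]] | [P]].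
  have [c' c'0 cE] := phiP P.
  exists P; last by apply: (@normalized_scale _ _ _ (c * c')); rewrite QE cE scalerA.
  move: hQ; rewrite QE inE PS -herm_value_mul herm_value_scale mulf_eq0 expf_eq0.
  by rewrite (negPf c0) andbF.
rewrite inE -herm_value_mul => /andP[PS hP] ->; have [c c0 cE] := phiP P.
move: hP; rewrite cE herm_value_scale mulf_eq0 expf_eq0 (negPf c0) andbF => hP.
split=> //; apply/existsP; exists P; rewrite PS; apply/existsP; exists c^-1.
by rewrite invr_eq0 c0 cE scalerA mulVf // scale1r eqxx.
Qed.

End Projectivity.

Theorem theorem1 (p t : nat) (F : finFieldType) (H U : {set point F}) :
  prime p -> (0 < t)%N -> #|F| = ((p ^ t) ^ 2)%N ->
  is_hermitian_unital (p ^ t) H -> is_unital (p ^ t) U ->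
  (#|H :&: U| = 1 %[mod p ^ uphalf t])%N /\
  (is_BM_unital (p ^ t) U -> (#|H :&: U| = 1 %[mod p ^ t])%N).
Proof.
move=> p_pr t_gt0 cardF [A [hA HE]] U_unital.
have {}cardF : #|F| = (p ^ (2 * t))%N by rewrite cardF -expnM mulnC.
have part1 : (#|H :&: U| = 1 %[mod p ^ uphalf t])%N.
  have [|W] := @galois_ring_exists F p (3 * t) (pcharF p_pr cardF); first by rewrite muln_gt0.
  have := unital_herm_neq0 W p_pr t_gt0 cardF (leqnn _) U_unital hA.
  have [+ _] := U_unital; rewrite -(cardsID H U) setIC.
  have -> : U :\: H = [set P in U | herm_value (p ^ t) A (val P) != 0%R].
    by apply/setP=> P; rewrite HE !inE andbC.
  move=> cardU dvd_neq.
  have /eqP : (#|H :&: U| + #|[set P in U | herm_value (p ^ t) A (val P) != 0%R]| =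
      0 * p ^ uphalf t + 1 %[mod p ^ uphalf t])%N.
    rewrite cardU -modnDml (_ : (p ^ t) ^ 3 %% _ = 0)%N //; apply/eqP.
    by rewrite -/(dvdn _ _) -expnM dvdn_exp2l //; lia.
  by rewrite -modnDmr (eqP dvd_neq) addn0 => /eqP.
split=> // -[alpha [beta [M [M_unit [BM_unital UE]]]]].
(* For [t = 1] the exponents [uphalf t] and [t] agree; for [t >= 2] one has [2 < q], as
   [bm_herm_mod] requires. *)
have [t1 | t_neq1] := eqVneq t 1%N; first by rewrite t1 in part1 *.
rewrite UE HE card_proj_image //; apply: bm_herm_mod => //.
  rewrite (@leq_trans (2 ^ 2)) // (leq_trans _ (leq_pexp2l _ (_ : 2 <= t)))%N //.
  - by rewrite leq_exp2r ?prime_gt1.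
  - exact: prime_gt0.
  - by case: (t) t_gt0 t_neq1 => [|[]].
exact: herm_pullback_hermitian.
Qed.
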